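(* Let $T$ be a finite event tree and let $C_0$ be the CEG of $T$ with the finest partition of situations into stages. If $C_0$ has a composite number $m$ of root-to-leaf paths and all CEGs Markov equivalent to $C_0$ have independent floret distributions, then the vector of probabilities on the root-to-leaf paths of $C_0$ must have a Dirichlet prior. In particular, for each situation of $C_0$ with at least two outgoing edges, the floret of that situation has a Dirichlet prior on the probability vector of its edges.
   Context: An event tree is a finite directed rooted tree; its situations are its non-leaf nodes and its atomic events are its root-to-leaf paths. The floret of a situation $v$ is the subtree consisting of $v$, its children and the edges joining them; it carries a vector $\boldsymbol{\pi}_v$ of positive conditional probabilities, summing to 1, on the edges out of $v$, and the probability of a root-to-leaf path is the product of the edge probabilities along it. These probabilities are uncertain, i.e. random with a prior distribution. A chain event graph (CEG) on an event tree is identified with a partition of the situations into stages, where situations in the same stage share the same edge-probability vector; $C_0$ is the CEG with the finest partition (each situation with at least two outgoing edges in its own stage). CEGs are Markov equivalent to $C_0$ here if they describe the same atomic events as $C_0$ with a different decomposition into florets: the path probabilities are transferred to another event tree $T'$ with $m$ root-to-leaf paths through a bijection of atomic events, and the induced probability of an edge $(v,v')$ of $T'$ is the sum of the probabilities of the paths through $v'$ divided by the sum of the probabilities of the paths through $v$. A CEG of this kind has independent floret distributions if the edge-probability vectors $\boldsymbol{\pi}_v$ of its different florets are mutually independent under the prior.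
   Formalization: The prior is assumed non-degenerate: the vector of root-to-leaf path probabilities is not almost surely constant (for a point-mass prior all florets are trivially independent but the law is not Dirichlet). *)

(* Defs.v *)
From HB Require Import structures.
From mathcomp Require Import all_boot all_order all_algebra.
From mathcomp Require Import all_classical all_reals all_analysis.

Set Implicit Arguments.
Unset Strict Implicit.
Unset Printing Implicit Defensive.

Import Order.TTheory GRing.Theory Num.Theory.
Import numFieldNormedType.Exports.

Local Open Scope classical_set_scope.
Local Open Scope ring_scope.

(* [edge u v] is the directed edge u -> v.  The three axioms say that the
   digraph is a tree with all edges directed away from [root]. *)
Record event_tree : Type := EventTree {
  node :> finType ;
  edge : rel node ;
  root : node ;
  root_orphan : forall u, ~~ edge u root ;
  one_parent : forall v, v != root -> #|[set u | edge u v]%SET| = 1%N ;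
  root_connect : forall v, connect edge root v }.

Arguments edge {e} _ _.
Arguments root {e}.

Section Trees.
Variable T : event_tree.

Definition leaf (v : T) : bool := [forall w, ~~ edge v w].

(* A root-to-leaf path is the sequence of its nodes after the root; in a tree
   its nodes are distinct, so the bound #|T| on the length excludes nothing and
   only serves to make the type finite. *)
Definition atomic_event : finType :=
  {s : {bseq #|T| of T} | path edge root s && leaf (last root s)}.

Definition path_nodes (s : atomic_event) : seq T := root :: val (val s).

Definition path_edges (s : atomic_event) : seq (T * T) :=
  zip (path_nodes s) (val (val s)).

Definition branching : {set T} := [set v | (1 < #|[set w | edge v w]|)%N]%SET.

Definition floret_edge (v : T) : finType := {w : T | edge v w}.

Section Probabilities.
Variables (R : realType) (Omega : Type).

(* Here and below [p u v] is the random conditional probability of the edge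
   u -> v; its value at pairs that are not edges is irrelevant. *)
Definition path_prob (p : T -> T -> Omega -> R) (s : atomic_event) (w : Omega)
  : R := \prod_(e <- path_edges s) p e.1 e.2 w.

Definition floret_vector (p : T -> T -> Omega -> R) (v : T)
  (e : floret_edge v) (w : Omega) : R := p v (val e) w.

End Probabilities.
End Trees.

(* A situation with a single outgoing edge has the constant vector (1) and
   belongs to no stage. *)
Record ceg : Type := CEG {
  ceg_tree :> event_tree ;
  stages : {set {set ceg_tree}} ;
  stages_partition : finset.partition stages (branching ceg_tree) }.

Fact finest_partition (T : event_tree) :
  finset.partition [set [set v]%SET | v in branching T]%SET (branching T).
Proof.
apply/and3P; split.
- rewrite /finset.cover; apply/eqP/setP => x; apply/finset.bigcupP/idP.
  + by case=> A /imsetP[v vT ->]; rewrite finset.inE => /eqP->.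
  + move=> xT; exists [set x]%SET; last by rewrite finset.inE.
    exact: imset_f.
- apply/finset.trivIsetP => A B /imsetP[u _ ->] /imsetP[v _ ->] uv.
  rewrite disjoints1 finset.inE.
  by apply: contraNneq uv => ->.
- apply/imsetP => -[v _] /setP/(_ v).
  by rewrite !finset.inE eqxx.
Qed.

Definition finest_ceg (T : event_tree) : ceg := CEG (finest_partition T).

Definition stage (C : ceg) : finType := {U : {set C} | U \in stages C}.

(* Situations in the same stage have the same edge-probability vector, up to
   an identification of the edges of their florets. *)
Definition respects_stages (R : realType) (Omega : Type) (C : ceg)
  (p : C -> C -> Omega -> R) : Prop :=
  forall U : {set C}, U \in stages C ->
  forall u v : C, u \in U -> v \in U ->
  exists2 h : floret_edge u -> floret_edge v, bijective h &
    forall e w, floret_vector p (h e) w = floret_vector p e w.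

(* The edge probability of u -> v induced on T' by the path probabilities [q]
   of T, transferred along a bijection [f] of atomic events. *)
Definition induced_edge_prob (R : realType) (Omega : Type) (T T' : event_tree)
  (q : atomic_event T -> Omega -> R) (f : atomic_event T -> atomic_event T')
  (u v : T') (w : Omega) : R :=
  (\sum_(s | v \in path_nodes (f s)) q s w) /
  (\sum_(s | u \in path_nodes (f s)) q s w).

(* C', with atomic events identified with those of C through [f], is Markov
   equivalent to C. *)
Definition markov_equivalent (R : realType) (Omega : Type) (C C' : ceg)
  (p : C -> C -> Omega -> R) (f : atomic_event C -> atomic_event C') : Prop :=
  bijective f /\ respects_stages (induced_edge_prob (path_prob p) f).

Section Random.
Context {d : measure_display} {Omega : measurableType d} {R : realType}
  (P : probability Omega R).

Definition random_edge_probabilities (T : event_tree)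
  (p : T -> T -> Omega -> R) : Prop :=
  [/\ forall u v, edge u v -> measurable_fun setT (p u v),
      forall u v w, edge u v -> 0 < p u v w &
      forall u w, ~~ leaf u -> \sum_(v | edge u v) p u v w = 1].

Definition sigma_of (J : Type) (X : J -> Omega -> R) : set (set Omega) :=
  <<s [set A | exists j, exists2 B : set R, measurable B & A = X j @^-1` B] >>.

Definition mutually_independent (I : finType) (J : I -> Type)
  (X : forall i, J i -> Omega -> R) : Prop :=
  forall A : I -> set Omega, (forall i, sigma_of (X i) (A i)) ->
  forall S : {set I},
    P (\bigcap_(i in [set` S]) A i) = (\prod_(i in S) P (A i))%E.

(* The florets of C are represented by one situation [r U] in each stage U. *)
Definition independent_florets (C : ceg) (p : C -> C -> Omega -> R) : Prop :=
  forall r : stage C -> C, (forall U, r U \in val U) ->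
  mutually_independent (fun U : stage C => floret_vector p (v := r U)).

Definition almost_surely_constant (J : Type) (X : J -> Omega -> R) : Prop :=
  exists c : J -> R, {ae P, forall w, forall j, X j w = c j}.

(* Integration over R^n with respect to Lebesgue measure, as an iterated
   integral; it is only applied to nonnegative Borel functions (Tonelli). *)
Fixpoint iterated_integral (n : nat) : (n.-tuple R -> \bar R) -> \bar R :=
  match n with
  | 0 => fun f => f [tuple]
  | n'.+1 => fun f =>
      (\int[lebesgue_measure]_x
         iterated_integral (fun t : n'.-tuple R => f (cons_tuple (x : R) t)))%E
  end.

(* The first n coordinates parametrise the hyperplane where all n + 1
   coordinates sum to 1. *)
Definition complete_to_one (n : nat) (t : n.-tuple R) : n.+1.-tuple R :=
  rcons_tuple t (1 - \sum_(i < n) tnth t i).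

Definition dirichlet_kernel (n : nat) (alpha : 'I_n.+1 -> R) (t : n.-tuple R)
  : R :=
  let y := complete_to_one t in
  if [forall i, 0 < tnth y i] then \prod_i tnth y i `^ (alpha i - 1) else 0.

(* The multivariate beta function, i.e.
   \prod_i Gamma (alpha i) / Gamma (\sum_i alpha i). *)
Definition dirichlet_norm (n : nat) (alpha : 'I_n.+1 -> R) : R :=
  fine (iterated_integral (fun t => (dirichlet_kernel alpha t)%:E)).

Definition dirichlet_law (n : nat) (alpha : 'I_n.+1 -> R)
  (B : set (n.+1.-tuple R)) : \bar R :=
  iterated_integral (fun t =>
    (\1_B (complete_to_one t) * dirichlet_kernel alpha t
       / dirichlet_norm alpha)%:E).

(* The Dirichlet family is symmetric, so the enumeration [e] of the index set
   is immaterial. *)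
Definition has_dirichlet_law (J : finType) (X : J -> Omega -> R) : Prop :=
  exists (n : nat) (e : 'I_n.+1 -> J) (alpha : J -> R),
    [/\ bijective e, (forall j, 0 < alpha j) &
      forall B : set (n.+1.-tuple R), measurable B ->
        P [set w | B [tuple X (e i) w | i < n.+1]]
        = dirichlet_law (alpha \o e) B].

End Random.

(* Main.v *)
(* Let q be the vector of path probabilities and A a proper set of at least two
   atomic events. In the tree whose root leads to the atomic events outside A
   and to one further situation, which leads to those in A, independence of the
   two florets says that (q_j / q(A))_{j in A} is independent of q(A). For A the
   complement of a single event i this gives, writing M(w) for the expectation
   of the product of the q_j over a word w,
     M(i w) = r_i(a, N) M(w),   a the multiplicity of i in w, N the length of w.
   The q_j sum to 1, so the r_i(a, N) sum to 1 over i, which forces them to be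
   affine in a with a slope independent of i; symmetry of M then makes the
   coefficients for N + 1 proportional to those for N. Hence either q is almost
   surely constant or
     M(i w) (|alpha| + N) = (alpha_i + a) M(w)
   for some positive alpha. These are the moments of the Dirichlet law, and as q
   is bounded its moments determine its law. The recursion passes to sums of
   the q_j over disjoint blocks, and then, by independence of q(A), to
   normalized block sums, among them the florets of the tree. *)

Require Import Defs.
From HB Require Import structures.
From mathcomp Require Import all_boot all_order all_algebra.
From mathcomp Require Import all_classical all_reals all_analysis.
From mathcomp Require Import measurable_realfun ring lra archimedean.

Set Implicit Arguments.
Unset Strict Implicit.
Unset Printing Implicit Defensive.

Import Order.TTheory GRing.Theory Num.Theory.
Import numFieldNormedType.Exports.

Local Open Scope classical_set_scope.
Local Open Scope ring_scope.

(** * Moment recursion from neutrality *)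

(** No density or smoothness of the prior is assumed, so there is no functional equation for
    densities to solve; everything runs on moments, which exist because the entries lie in [0, 1]. A
    constant vector has to be set aside: its florets are independent in every tree, and it shows up
    in the recursion as slope zero. Three atomic events make affinity provable: one letter can be
    exchanged for another while a third fills up the word. Two obstacles shape the passage from
    moments to the law. The Dirichlet density is unbounded near the boundary when some parameter is
    below 1, so both laws are compared after weighting by the product of the entries, and the weight
    is divided out at the end. And the law is given by an iterated integral rather than by a measure
    on tuples; since the integrands vanish off the unit cube, the uniform probability there
    represents it. Uniqueness from moments is proved for weighted measures so that it applies to one
    coordinate at a time, the others sitting in the weight. *)

Section Recursion.
Variables (R : archiRealFieldType) (J : finType) (M : seq J -> R)
  (r : J -> nat -> nat -> R).
Hypothesis card_J : (2 < #|J|)%N.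
Hypothesis M_gt0 : forall w, 0 < M w.
Hypothesis M_nil : M [::] = 1.
Hypothesis M_perm : forall w w', perm_eq w w' -> M w = M w'.
Hypothesis M_sum : forall w, \sum_i M (i :: w) = M w.
Hypothesis M_r : forall i w, M (i :: w) = r i (count_mem i w) (size w) * M w.

(** The letter that pads a word to length [N] without touching the counts of [i] and [j]; every
    value [r i a N] with [a <= N] is thereby attained by a word. *)
Let third i j : exists l : J, (l != i) && (l != j).
Proof.
apply/existsP; rewrite -[X in is_true X]negbK negb_exists; apply/negP => /forallP h.
have : (#|J| <= #|[set i; j]%SET|)%N.
  rewrite -cardsT; apply/subset_leq_card/fintype.subsetP => l _.
  by move: (h l); rewrite negb_and !negbK !finset.inE.
by rewrite cards2 leqNgt (leq_trans _ card_J)// ltnS; case: (_ != _).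
Qed.

Let word3 (i j l : J) a b c : exists w : seq J, size w = (a + (b + c))%N /\
  forall t, count_mem t w = ((i == t) * a + ((j == t) * b + (l == t) * c))%N.
Proof.
exists (nseq a i ++ nseq b j ++ nseq c l).
by rewrite !size_cat !size_nseq; split=> // t; rewrite !count_cat !count_nseq.
Qed.

Let r_gt0 i w : 0 < r i (count_mem i w) (size w).
Proof. by have := M_gt0 (i :: w); rewrite M_r pmulr_lgt0. Qed.

Let r_word_gt0 i a N : (a <= N)%N -> 0 < r i a N.
Proof.
move=> aN; have [l /andP[li _]] := third i i.
have [w [sw cw]] := word3 i l l a 0 (N - a); have := r_gt0 i w.
by rewrite cw sw eqxx (negbTE li) mul0n !addn0 add0n mul1n subnKC.
Qed.

Let r_sum w : \sum_i r i (count_mem i w) (size w) = 1.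
Proof.
apply: (mulIf (lt0r_neq0 (M_gt0 w))); rewrite mul1r mulr_suml -[RHS]M_sum.
by apply: eq_bigr => i _; rewrite M_r.
Qed.

(** Exchanging one [i] for one [j] in a word alters only these two terms of [r_sum]. As the right
    side does not mention [a], [r i] is affine in the count. *)
Let r_incr i j a N : i != j -> (a < N)%N ->
  r i a.+1 N - r i a N = r j 1%N N - r j 0%N N.
Proof.
move=> ij aN; have [l /andP[li lj]] := third i j.
have [w [sw cw]] := word3 i j l a.+1 0 (N - a.+1).
have [w' [sw' cw']] := word3 i j l a 1 (N - a.+1).
have := r_sum w; rewrite -(r_sum w') sw sw'.
have -> : (a.+1 + (0 + (N - a.+1)))%N = N by rewrite add0n subnKC.
have -> : (a + (1 + (N - a.+1)))%N = N by rewrite add1n subnSK// subnKC// ltnW.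
rewrite (bigD1 i)//= (bigD1 j)/=; last by rewrite eq_sym.
rewrite [RHS](bigD1 i)//= [in RHS](bigD1 j)/=; last by rewrite eq_sym.
rewrite !cw !cw' !eqxx (negbTE li) (negbTE lj) (eq_sym j) (negbTE ij).
rewrite !mul0n !mul1n !addn0 add0n !addrA => e.
suff E : \sum_(k | (k != i) && (k != j)) r k (count_mem k w) N
  = \sum_(k | (k != i) && (k != j)) r k (count_mem k w') N.
  by move: e; rewrite E => /addIr h; lra.
apply: eq_bigr => k /andP[ki kj]; rewrite cw cw'.
by rewrite !(eq_sym _ k) (negbTE ki) (negbTE kj) !mul0n.
Qed.

(** The two sides come from the two orders in which [i] and [j] can be taken off the front of a
    word. They tie the growth of [r] in the length for [i] to that for [j]. *)
Let r_comm i j a b N : i != j -> (a + b <= N)%N ->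
  r i a N.+1 * r j b N = r j b N.+1 * r i a N.
Proof.
move=> ij abN; have [l /andP[li lj]] := third i j.
have [w [sw cw]] := word3 i j l a b (N - (a + b)).
have {}sw : size w = N by rewrite sw addnA subnKC.
have ci : count_mem i w = a.
  by rewrite cw eqxx (negbTE li) (eq_sym j) (negbTE ij) mul1n !addn0.
have cj : count_mem j w = b.
  by rewrite cw eqxx (negbTE lj) (negbTE ij) mul1n addn0 add0n.
have : M [:: i, j & w] = M [:: j, i & w].
  by apply: M_perm; apply/permP => p /=; rewrite addnCA.
rewrite !M_r/= sw ci cj (eq_sym j) (negbTE ij) !add0n !mulrA.
by move/(mulIf (lt0r_neq0 (M_gt0 w))).
Qed.

(* The second case is that of a degenerate vector: equality of the second moment
   with the square of the first. *)
Lemma moment_recursion_dichotomy :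
  (exists alpha : J -> R, (forall j, 0 < alpha j) /\
    forall j w, M (j :: w) * (\sum_i alpha i + (size w)%:R)
      = (alpha j + (count_mem j w)%:R) * M w) \/
  (forall j, M [:: j; j] = M [:: j] ^+ 2).
Proof.
have [i0 _] : exists i : J, true.
  by have /card_gt0P[i _] : (0 < #|J|)%N by exact: leq_trans card_J; exists i.
have [j0 /andP[j0i0 _]] := third i0 i0.
pose del N := r i0 1%N N - r i0 0%N N.
have incr i a N : (a < N)%N -> r i a.+1 N - r i a N = del N.
  move=> aN; have [->|ii0] := eqVneq i i0; last by rewrite (r_incr ii0).
  (* The letter [i0] cannot be compared with itself; the comparison goes to [j0] and back. *)
  have h : i0 != j0 by rewrite eq_sym.
  by rewrite (r_incr h aN) /del (r_incr h (leq_ltn_trans (leq0n a) aN)).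
have lin i a N : (a <= N)%N -> r i a N = r i 0%N N + a%:R * del N.
  elim: a => [|a ih] aN; first by rewrite mul0r addr0.
  have := incr i a N aN; rewrite ih ?(ltnW aN)// -natr1 => /eqP.
  by rewrite subr_eq => /eqP ->; ring.
pose lam N := r i0 0%N N.+1 / r i0 0%N N.
have r0n0 i N : r i 0%N N != 0 by rewrite lt0r_neq0// r_word_gt0.
have lamE i a N : (a <= N)%N -> r i a N.+1 = lam N * r i a N.
  have lam' j b : j != i0 -> (b <= N)%N -> r j b N.+1 = lam N * r j b N.
    move=> ji0 bN; apply: (mulIf (r0n0 i0 N)); rewrite (r_comm ji0) ?addn0//.
    by rewrite /lam; field.
  move=> aN; have [->|ii0] := eqVneq i i0; last exact: lam'.
  apply: (mulIf (r0n0 j0 N)); rewrite (@r_comm i0 j0) ?addn0 1?eq_sym// lam'//.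
  by ring.
pose c i := r i 0%N 1%N.
(* Length 1 is the base because [del 0] involves [r i0 1 0], which no word realizes. *)
have prop N : exists L, (forall i, r i 0%N N.+1 = L * c i) /\ del N.+1 = L * del 1%N.
  elim: N => [|N [L [h1 h2]]]; first by exists 1; split=> [i|]; rewrite mul1r.
  exists (lam N.+1 * L); split=> [i|]; first by rewrite (lamE i 0%N N.+1)// h1 mulrA.
  have -> : del N.+2 = lam N.+1 * del N.+1.
    by rewrite /del (lamE i0 1%N N.+1)// (lamE i0 0%N N.+1)// mulrBr.
  by rewrite h2 mulrA.
pose C := \sum_i c i.
have sumc w : (\sum_i count_mem i w = size w)%N.
  elim: w => [|x w ih] /=; first by rewrite big1.
  rewrite big_split/= ih (bigD1 x)//= eqxx big1 ?add1n ?addn0//.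
  by move=> i ix; rewrite eq_sym (negbTE ix).
have main i w : r i (count_mem i w) (size w) * (C + (size w)%:R * del 1%N)
    = c i + (count_mem i w)%:R * del 1%N.
  have cw := count_size (pred1 i) w.
  have [s0|] := posnP (size w).
    have -> : w = [::] by apply: size0nil.
    rewrite /= !mul0r !addr0 /C/c.
    rewrite (eq_bigr (fun j => lam 0%N * r j 0%N 0%N)) => [|j _]; last exact: lamE.
    by rewrite -mulr_sumr (r_sum [::]) mulr1 lamE// mulrC.
  case sw : (size w) => [//|N] _.
  have [L [h1 h2]] := prop N.
  (* The factor [L] is fixed by [r_sum], since the counts of all letters add up to the length. *)
  have e : L * (C + N.+1%:R * del 1%N) = 1.
    rewrite -[RHS](r_sum w) sw.
    rewrite (eq_bigr (fun j => L * c j + (count_mem j w)%:R * (L * del 1%N))); last first.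
      by move=> j _; rewrite lin -?sw ?count_size// sw h1 h2.
    rewrite big_split/= -mulr_sumr -mulr_suml -natr_sum sumc sw /C; ring.
  rewrite lin -?sw// sw h1 h2.
  have -> : L * c i + (count_mem i w)%:R * (L * del 1%N)
      = L * (c i + (count_mem i w)%:R * del 1%N) by ring.
  by rewrite mulrAC e mul1r.
have c_gt0 i : 0 < c i by exact: r_word_gt0.
have C_gt0 : 0 < C.
  rewrite /C (bigD1 i0)//= ltr_wpDr//; by rewrite sumr_ge0// => i _; exact: ltW.
(* In a word of [N] letters [i0] the count of [j0] is 0, so [main] equates a positive multiple of
   this quantity with [c j0]. This will exclude a negative slope. *)
have CN_gt0 N : 0 < C + N%:R * del 1%N.
  have := main j0 (nseq N i0); rewrite size_nseq count_nseq/= (eq_sym i0) (negbTE j0i0)/=.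
  rewrite mul0n mul0r addr0 => e.
  have : 0 < r j0 0%N N by exact: r_word_gt0.
  by move=> h; rewrite -(pmulr_rgt0 _ h) e.
have [d0|d0|d0] := ltgtP (del 1%N) 0.
- exfalso; have : (0 : R) <= C / - del 1%N by rewrite divr_ge0 ?oppr_ge0 ?ltW.
  case/archi_boundP; set N := Num.bound _ => hN.
  have := CN_gt0 N; move: hN; rewrite ltr_pdivrMr ?oppr_gt0//; lra.
- left; exists (fun i => c i / del 1%N); split=> [j|j w]; first exact: divr_gt0.
  have h := main j w; rewrite M_r -mulr_suml -/C.
  have dn : del 1%N != 0 by rewrite lt0r_neq0.
  have -> : C / del 1%N + (size w)%:R = (C + (size w)%:R * del 1%N) / del 1%N by field.
  have -> : c j / del 1%N + (count_mem j w)%:R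
      = (c j + (count_mem j w)%:R * del 1%N) / del 1%N by field.
  by rewrite -h; ring.
(* With slope zero, [main] makes [r j] constant, and the letters behave like independent draws. *)
- right=> j; rewrite !M_r/=.
  have := main j [:: j]; have := main j [::]; rewrite /= eqxx d0 !mulr0 !addr0 => <-.
  move/(mulIf (lt0r_neq0 C_gt0)) => ->.
  by rewrite M_nil; ring.
Qed.
End Recursion.

(** * Weighted image measures *)

Section Weighted.
Context {d d' : measure_display} {T : measurableType d} {T' : measurableType d'}
  {R : realType} (mu : {measure set T -> \bar R}).
Variables (X : T -> T') (W : T -> R).
Hypotheses (mX : measurable_fun setT X) (mW : measurable_fun setT W)
  (W0 : forall x, 0 <= W x).

(** The hypotheses are arguments so that the measure structure below can be attached to this
    function. *)
Definition weighted_law (_ : measurable_fun setT X) (_ : measurable_fun setT W)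
  (_ : forall x, 0 <= W x) (B : set T') : \bar R :=
  (\int[mu]_x (\1_B (X x) * W x)%:E)%E.

Local Notation nu := (weighted_law mX mW W0).

Let nuE B : nu B = (\int[mu]_(x in X @^-1` B) (W x)%:E)%E.
Proof.
rewrite integral_mkcond epatch_indic; apply: eq_integral => x _ /=.
by rewrite -EFinM mulrC.
Qed.

Let nu0 : nu set0 = 0%E. Proof. by rewrite nuE preimage_set0 integral_set0. Qed.

Let nu_ge0 B : (0 <= nu B)%E.
Proof. by apply: integral_ge0 => x _; rewrite lee_fin mulr_ge0. Qed.

Let nu_sigma_additive : semi_sigma_additive nu.
Proof.
move=> F mF tF mUF; rewrite nuE preimage_bigcup.
rewrite (_ : (fun _ => _) = (fun n => \sum_(0 <= i < n)
    \int[mu]_(x in X @^-1` F i) (W x)%:E)%E); last first.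
  by apply/funext => n; apply: eq_bigr => i _; rewrite nuE.
apply: (@semi_sigma_additive_nng_induced _ _ _ mu (EFin \o W)) => //.
- exact/measurable_EFinP.
- by move=> i; rewrite -[_ @^-1` _]setTI; exact: mX.
- apply/trivIsetP => i j _ _ ij; rewrite -preimage_setI.
  by move/trivIsetP : tF => /(_ i j Logic.I Logic.I ij) ->; rewrite preimage_set0.
- by rewrite -preimage_bigcup -[_ @^-1` _]setTI; exact: mX.
Qed.

HB.instance Definition _ := isMeasure.Build _ _ _ nu nu0 nu_ge0 nu_sigma_additive.

Definition weighted_measure : {measure set T' -> \bar R} := nu.

End Weighted.

Section EqWeighted.
Context {d1 d2 d' : measure_display} {T1 : measurableType d1}
  {T2 : measurableType d2} {T' : measurableType d'} {R : realType}
  (mu1 : {measure set T1 -> \bar R}) (mu2 : {measure set T2 -> \bar R}).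
Variables (X1 : T1 -> T') (X2 : T2 -> T') (W1 : T1 -> R) (W2 : T2 -> R).
Hypotheses (mX1 : measurable_fun setT X1) (mX2 : measurable_fun setT X2)
  (mW1 : measurable_fun setT W1) (mW2 : measurable_fun setT W2)
  (W10 : forall x, 0 <= W1 x) (W20 : forall x, 0 <= W2 x).

Lemma weighted_law_unique (G : set (set T')) :
  measurable = <<s G >> -> setI_closed G -> G setT ->
  (\int[mu1]_x (W1 x)%:E < +oo)%E ->
  (forall B, G B -> \int[mu1]_x (\1_B (X1 x) * W1 x)%:E
                  = \int[mu2]_x (\1_B (X2 x) * W2 x)%:E)%E ->
  forall B, measurable B -> (\int[mu1]_x (\1_B (X1 x) * W1 x)%:E
                  = \int[mu2]_x (\1_B (X2 x) * W2 x)%:E)%E.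
Proof.
move=> mG GI GT fin GE B mB.
apply: (@measure_unique _ R T' G (fun=> setT) mG GI _ _
  (weighted_measure mu1 mX1 mW1 W10) (weighted_measure mu2 mX2 mW2 W20)) => //.
- by rewrite bigcup_const.
- move=> _; rewrite [X in (X < _)%E](_ : _ = \int[mu1]_x (W1 x)%:E)%E//.
  by apply: eq_integral => x _; rewrite indicE in_setT mul1r.
Qed.

Import HBNNSimple.

(** Monotone convergence along simple functions. The test function must be nonnegative on all of
    [T'], which is why later ones carry absolute values. *)
Lemma eq_integral_weighted :
  (forall B, measurable B -> \int[mu1]_x (\1_B (X1 x) * W1 x)%:E
                  = \int[mu2]_x (\1_B (X2 x) * W2 x)%:E)%E ->
  forall g : T' -> R, measurable_fun setT g -> (forall y, 0 <= g y) ->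
  (\int[mu1]_x (g (X1 x) * W1 x)%:E = \int[mu2]_x (g (X2 x) * W2 x)%:E)%E.
Proof.
move=> BE g mg g0.
have mg' : measurable_fun setT (EFin \o g) by exact/measurable_EFinP.
pose h := nnsfun_approx measurableT mg'.
have lim d (T : measurableType d) (mu : {measure set T -> \bar R}) (X : T -> T')
    (W : T -> R) : measurable_fun setT X -> measurable_fun setT W ->
    (forall x, 0 <= W x) ->
    (\int[mu]_x (g (X x) * W x)%:E =
      limn (fun n => \int[mu]_x (h n (X x) * W x)%:E))%E.
  move=> mX mW W0.
  have hX n : measurable_fun setT (fun x => h n (X x)).
    exact: (measurableT_comp _ mX).
  rewrite -monotone_convergence//.
  - apply: eq_integral => x _; apply/esym/cvg_lim => //.
    under eq_fun do rewrite EFinM; rewrite EFinM.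
    apply: cvgeZr => //.
    by apply: (@cvg_nnsfun_approx _ _ _ _ measurableT _ mg') => // y _; rewrite lee_fin.
  - by move=> n; apply/measurable_EFinP; exact: measurable_funM.
  - by move=> n x _; rewrite lee_fin mulr_ge0.
  - move=> x _ a b ab; rewrite lee_fin ler_wpM2r//.
    exact/lefP/nd_nnsfun_approx.
rewrite !lim//; congr (limn _); apply/funext => n.
have simple d (T : measurableType d) (mu : {measure set T -> \bar R}) (X : T -> T')
    (W : T -> R) : measurable_fun setT X -> measurable_fun setT W ->
    (forall x, 0 <= W x) ->
    (\int[mu]_x (h n (X x) * W x)%:E = \sum_(y \in range (h n))
      y%:E * \int[mu]_x (\1_(h n @^-1` [set y]) (X x) * W x)%:E)%E.
  move=> mX mW W0.
  have mh y : measurable (h n @^-1` [set y]) by exact: measurable_sfunP.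
  have m1 y : measurable_fun setT (fun x => \1_(h n @^-1` [set y]) (X x) * W x).
    apply: measurable_funM => //; apply: (measurableT_comp _ mX).
    exact: measurable_indic.
  have r0 y x : (0 <= (y * \1_(h n @^-1` [set y]) x)%:E)%E by exact: nnfun_muleindic_ge0.
  rewrite (eq_integral (fun x => \sum_(y \in range (h n))
      (y * \1_(h n @^-1` [set y]) (X x) * W x)%:E))%E; last first.
    move=> x _; rewrite fimfunE.
    rewrite EFinM -fsumEFin// ge0_mule_fsuml//.
  rewrite ge0_integral_fsum//.
  - apply: eq_fsbigr => y; rewrite inE => -[z _ <-].
    rewrite -ge0_integralZl//; last 3 first.
    + exact/measurable_EFinP.
    + by move=> x _; rewrite lee_fin mulr_ge0.
    + by rewrite lee_fin.
    by apply: eq_integral => x _; rewrite -EFinM mulrA.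
  - move=> y; apply/measurable_EFinP; under eq_fun do rewrite -mulrA.
    exact: measurable_funM.
  - by move=> y x _; rewrite EFinM mule_ge0// lee_fin.
rewrite !simple//; apply: eq_fsbigr => y _; rewrite BE//.
Qed.

End EqWeighted.

(** * Moments determine measures on cubes *)

(* The expectation of [g S] for [S] a binomial variable with parameters [n]
   and [x]. *)
Fixpoint bernstein (R : comNzRingType) (n : nat) (g : nat -> R) (x : R) : R :=
  if n is n'.+1 then
    x * bernstein n' (fun k => g k.+1) x + (1 - x) * bernstein n' g x
  else g 0%N.

Lemma bernstein_poly (R : comNzRingType) n (g : nat -> R) :
  exists p : {poly R}, forall x, p.[x] = bernstein n g x.
Proof.
elim: n g => [|n ih] g; first by exists (g 0%N)%:P => x; rewrite hornerC.
have [p pE] := ih (fun k => g k.+1); have [q qE] := ih g.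
by exists ('X * p + (1 - 'X) * q) => x /=; rewrite !hornerE pE qE.
Qed.

Lemma bernstein_affine (R : comNzRingType) n (g : nat -> R) a b x :
  bernstein n (fun k => a + b * g k) x = a + b * bernstein n g x.
Proof. by elim: n g => [//|n ih] g /=; rewrite !ih; ring. Qed.

(** Variance of the binomial variable plus the squared distance of its mean from [c]. The free
    centre lets the induction absorb a success as a shift by 1. *)
Lemma bernstein_sqr_dist (R : comNzRingType) n (c x : R) :
  bernstein n (fun k => (k%:R - c) ^+ 2) x
  = n%:R * x * (1 - x) + (n%:R * x - c) ^+ 2.
Proof.
elim: n c => [|n ih] c /=; first by ring.
rewrite ih (_ : (fun k => _) = (fun k => (k%:R - (c - 1)) ^+ 2)); last first.
  by apply/funext => k; rewrite -natr1; ring.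
by rewrite ih -natr1; ring.
Qed.

Lemma ler_norm_bernstein (R : realDomainType) n (g h : nat -> R) x :
  0 <= x <= 1 -> (forall k, `|g k| <= h k) ->
  `|bernstein n g x| <= bernstein n h x.
Proof.
move=> /andP[x0 x1]; elim: n g h => [|n ih] g h gh //=.
apply: (le_trans (ler_normD _ _)).
rewrite !normrM (ger0_norm x0) (ger0_norm (_ : 0 <= 1 - x)) ?subr_ge0//.
by rewrite lerD// ler_wpM2l ?subr_ge0// ih.
Qed.

(** With [N ^ 2] trials the relative frequency deviates from [x] by the order of [1/N]. *)
Lemma bernstein_approx (R : realFieldType) (f : R -> R) (L : R) N :
  0 <= L -> (0 < N)%N -> (forall x y, `|f x - f y| <= L * `|x - y|) ->
  forall x, 0 <= x <= 1 ->
  `|f x - bernstein (N ^ 2) (fun k => f (k%:R / (N ^ 2)%:R)) x| <= 2 * L / N%:R.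
Proof.
move=> L0 N0 fL x x01.
have n0 : N%:R != 0 :> R by rewrite pnatr_eq0 -lt0n.
have n1 : 0 < N%:R :> R by rewrite ltr0n.
set n := (N ^ 2)%N.
have -> : f x - bernstein n (fun k => f (k%:R / n%:R)) x
    = bernstein n (fun k => f x + (-1) * f (k%:R / n%:R)) x.
  by rewrite bernstein_affine mulN1r.
(* A quadratic majorant of the Lipschitz bound, from [v <= 1/N + N v^2]; it reduces the estimate to
   the second moment without a square root. *)
pose h k := L / N%:R + (L / N%:R ^+ 3) * (k%:R - n%:R * x) ^+ 2.
apply: (le_trans (@ler_norm_bernstein _ _ _ h _ x01 _)).
  move=> k; rewrite mulN1r (le_trans (fL _ _))// /h.
  set u := x - _; have -> : k%:R - n%:R * x = - (N%:R ^+ 2 * u).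
    by rewrite /u /n natrX; field.
  have -> : L / N%:R + L / N%:R ^+ 3 * (- (N%:R ^+ 2 * u)) ^+ 2 =
    L * (N%:R^-1 + N%:R * u ^+ 2) by field.
  rewrite ler_wpM2l// -[u ^+ 2]real_normK ?num_real//; set v := `|u|.
  have : 0 <= N%:R^-1 * (1 - N%:R * v) ^+ 2.
    by rewrite mulr_ge0 ?invr_ge0 ?sqr_ge0// ltW.
  have -> : N%:R^-1 * (1 - N%:R * v) ^+ 2 = N%:R^-1 + N%:R * v ^+ 2 - v - v by field.
  have : 0 <= v by exact: normr_ge0.
  lra.
rewrite bernstein_affine bernstein_sqr_dist subrr expr0n/= addr0 /n natrX.
have -> : L / N%:R + L / N%:R ^+ 3 * (N%:R ^+ 2 * x * (1 - x)) =
  L / N%:R * (1 + x * (1 - x)) by field.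
case/andP: x01 => x0 x1; have -> : 2 * L / N%:R = L / N%:R * 2 by ring.
rewrite ler_wpM2l ?divr_ge0//.
nra.
Qed.

Lemma clamp_dist (R : realDomainType) (u v : R) :
  `|Num.max 0 (Num.min 1 u) - Num.max 0 (Num.min 1 v)| <= `|u - v|.
Proof.
have := ler_norm (u - v); have := ler_norm (v - u); rewrite distrC.
set a := `|u - v| => h1 h2; rewrite ler_norml /Num.max /Num.min.
by do ![case: ifPn]; rewrite -?leNgt; lra.
Qed.

Section MomentUniqueness.
Context {d1 d2 : measure_display} {T1 : measurableType d1}
  {T2 : measurableType d2} {R : realType}
  (mu1 : {measure set T1 -> \bar R}) (mu2 : {measure set T2 -> \bar R}).
Variables (X1 : T1 -> R) (X2 : T2 -> R) (W1 : T1 -> R) (W2 : T2 -> R).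
Hypotheses (mX1 : measurable_fun setT X1) (mX2 : measurable_fun setT X2)
  (mW1 : measurable_fun setT W1) (mW2 : measurable_fun setT W2)
  (W10 : forall x, 0 <= W1 x) (W20 : forall x, 0 <= W2 x)
  (X101 : forall x, 0 <= X1 x <= 1) (X201 : forall x, 0 <= X2 x <= 1)
  (W1fin : (\int[mu1]_x (W1 x)%:E < +oo)%E).
Hypothesis moments : forall k, (\int[mu1]_x (X1 x ^+ k * W1 x)%:E
  = \int[mu2]_x (X2 x ^+ k * W2 x)%:E)%E.

Let integrableW d (T : measurableType d) (mu : {measure set T -> \bar R})
    (W : T -> R) : measurable_fun setT W -> (forall x, 0 <= W x) ->
  (\int[mu]_x (W x)%:E < +oo)%E -> mu.-integrable setT (EFin \o W).
Proof.
move=> mW W0 fin; apply/integrableP; split; first exact/measurable_EFinP.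
by under eq_integral do rewrite gee0_abs ?lee_fin//.
Qed.

Let integrable_weight d (T : measurableType d) (mu : {measure set T -> \bar R})
    (X W : T -> R) (f : R -> R) (C : R) :
  measurable_fun setT X -> measurable_fun setT W -> (forall x, 0 <= W x) ->
  (forall x, 0 <= X x <= 1) -> (\int[mu]_x (W x)%:E < +oo)%E ->
  measurable_fun setT f -> (forall x, 0 <= x <= 1 -> `|f x| <= C) ->
  mu.-integrable setT (EFin \o (fun x => f (X x) * W x)).
Proof.
move=> mX mW W0 X01 fin mf fC.
apply: (@le_integrable _ _ _ _ _ _ _ (fun x => C%:E * (W x)%:E)%E) => //.
- apply/measurable_EFinP; apply: measurable_funM => //.
  exact: (measurableT_comp mf mX).
- move=> x _ /=; rewrite !lee_fin !normrM ler_wpM2r//.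
  by rewrite (le_trans (fC _ (X01 x)))// ler_norm.
- by apply: integrableZl => //; exact: integrableW.
Qed.

Let W2fin : (\int[mu2]_x (W2 x)%:E < +oo)%E.
Proof.
rewrite (le_lt_trans _ W1fin)//; have := moments 0.
under eq_integral do rewrite expr0 mul1r.
by under [in RHS]eq_integral do rewrite expr0 mul1r; move=> ->.
Qed.

Let bounded (f : R -> R) := exists C, forall x, 0 <= x <= 1 -> `|f x| <= C.

Let int1 (f : R -> R) : measurable_fun setT f -> bounded f ->
  mu1.-integrable setT (EFin \o (fun x => f (X1 x) * W1 x)).
Proof. by move=> mf [C fC]; exact: (integrable_weight _ _ _ _ _ _ fC). Qed.

Let int2 (f : R -> R) : measurable_fun setT f -> bounded f ->
  mu2.-integrable setT (EFin \o (fun x => f (X2 x) * W2 x)).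
Proof. by move=> mf [C fC]; exact: (integrable_weight _ _ _ _ _ _ fC). Qed.

Let I1 (f : R -> R) : R := \int[mu1]_x (f (X1 x) * W1 x).
Let I2 (f : R -> R) : R := \int[mu2]_x (f (X2 x) * W2 x).

Let I_cst : I1 (cst 1) = I2 (cst 1).
Proof.
rewrite /I1 /I2 /Rintegral; congr fine; have := moments 0.
under eq_integral do rewrite expr0.
by under [in RHS]eq_integral do rewrite expr0.
Qed.

Let mpoly (p : {poly R}) : measurable_fun setT (fun x => p.[x]).
Proof.
apply: continuous_measurable_fun => x.
exact: continuous_horner.
Qed.

Let bpoly (p : {poly R}) : bounded (fun x => p.[x]).
Proof.
exists (\sum_(i < size p) `|p`_i|) => x /andP[x0 x1].
rewrite horner_coef (le_trans (ler_norm_sum _ _ _))// ler_sum// => i _.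
by rewrite normrM ler_piMr// normrX exprn_ile1// ger0_norm.
Qed.

Let I_poly (p : {poly R}) : I1 (fun x => p.[x]) = I2 (fun x => p.[x]).
Proof.
(* The extra power makes the Horner induction close: multiplication by ['X] raises [k]. *)
suff: forall k, I1 (fun x => x ^+ k * p.[x]) = I2 (fun x => x ^+ k * p.[x]).
  move=> /(_ 0%N); rewrite /I1 /I2.
  under eq_Rintegral do rewrite expr0 mul1r.
  by under [in RHS]eq_Rintegral do rewrite expr0 mul1r.
elim/poly_ind: p => [|p c ih] k.
  rewrite /I1 /I2; under eq_Rintegral do rewrite horner0 mulr0 mul0r.
  under [in RHS]eq_Rintegral do rewrite horner0 mulr0 mul0r.
  by rewrite /Rintegral !integral0.
have e x : x ^+ k * (p * 'X + c%:P).[x] = ('X^(k.+1) * p).[x] + (c *: 'X^k).[x].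
  by rewrite !hornerE exprS; ring.
rewrite /I1 /I2; under eq_Rintegral do rewrite e mulrDl.
under [in RHS]eq_Rintegral do rewrite e mulrDl.
rewrite !RintegralD//; [|exact: int2|exact: int2|exact: int1|exact: int1].
congr (_ + _).
  have := ih k.+1; rewrite /I1 /I2.
  under eq_Rintegral do rewrite -hornerXn -hornerM.
  by under [in RHS]eq_Rintegral do rewrite -hornerXn -hornerM.
under eq_Rintegral do rewrite hornerZ hornerXn -mulrA.
under [in RHS]eq_Rintegral do rewrite hornerZ hornerXn -mulrA.
rewrite !RintegralZl//.
- by congr (c * _); rewrite /Rintegral moments.
- have := int2 (mpoly 'X^k) (bpoly _); apply: eq_integrable => // x _ /=.
  by rewrite hornerXn.
- have := int1 (mpoly 'X^k) (bpoly _); apply: eq_integrable => // x _ /=.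
  by rewrite hornerXn.
Qed.

(** The two functionals agree on Bernstein polynomials and have the same total mass, so a uniform
    approximation error costs the same on both sides. *)
Let I_lipschitz (f : R -> R) (L : R) : 0 <= L ->
  (forall x y, `|f x - f y| <= L * `|x - y|) -> I1 f = I2 f.
Proof.
move=> L0 fL.
have mf : measurable_fun setT f.
  apply: continuous_measurable_fun => x; apply/cvgrPdist_le => e e0.
  near=> y; rewrite (le_trans (fL _ _))//.
  have : `|x - y| <= e / (L + 1).
    near: y; apply: cvgr_dist_le; [exact: cvg_id|].
    by rewrite divr_gt0// ltr_wpDl.
  rewrite ler_pdivlMr ?ltr_wpDl// => h; rewrite (le_trans _ h)// mulrC ler_wpM2l//.
  lra.
have bf : bounded f.
  exists (`|f 0| + L) => x /andP[x0 x1]; rewrite -(subrK (f 0) (f x)).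
  rewrite (le_trans (ler_normD _ _))// addrC lerD2l (le_trans (fL _ _))//.
  by rewrite subr0 ger0_norm// ler_piMr.
apply/eqP; rewrite -subr_eq0 -normr_le0; apply/ler_addgt0Pl => e e0; rewrite addr0.
set m := I1 (cst 1).
have m0 : 0 <= m by apply: Rintegral_ge0 => x _; rewrite mul1r.
(* Each side contributes an error of [2 L m / N]; this [N] makes their sum at most [e], and the
   successor keeps it positive. *)
pose N := (Num.bound (4 * L * m / e)).+1.
have [p pE] := bernstein_poly (N ^ 2) (fun k => f (k%:R / (N ^ 2)%:R)).
have close x : 0 <= x <= 1 -> `|f x - p.[x]| <= 2 * L / N%:R.
  by move=> x01; rewrite pE; exact: bernstein_approx.
have mfp : measurable_fun setT (fun x => f x - p.[x]) by exact: measurable_funB.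
have bfp : bounded (fun x => f x - p.[x]) by exists (2 * L / N%:R).
have b1 : bounded (fun=> 2 * L / N%:R) by exists `|2 * L / N%:R|.
have cl1 : `|I1 f - I1 (fun x => p.[x])| <= 2 * L / N%:R * m.
  rewrite /I1 -RintegralB//; [|exact: int1|exact: int1].
  under eq_Rintegral do rewrite -mulrBl.
  apply: (le_trans (le_normr_Rintegral _ _)) => //; first exact: (int1 mfp bfp).
  have -> : 2 * L / N%:R * m = \int[mu1]_x ((2 * L / N%:R) * W1 x).
    rewrite /m /I1; under [in LHS]eq_Rintegral do rewrite mul1r.
    by rewrite RintegralZl//; exact: integrableW.
  apply: le_Rintegral => //.
  - exact: (integrable_norm (int1 mfp bfp)).
  - exact: (int1 (measurable_cst _) b1).
  - by move=> x _; rewrite normrM (ger0_norm (W10 x)) ler_wpM2r// close.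
have cl2 : `|I2 f - I2 (fun x => p.[x])| <= 2 * L / N%:R * m.
  rewrite /I2 -RintegralB//; [|exact: int2|exact: int2].
  under eq_Rintegral do rewrite -mulrBl.
  apply: (le_trans (le_normr_Rintegral _ _)) => //; first exact: (int2 mfp bfp).
  have -> : 2 * L / N%:R * m = \int[mu2]_x ((2 * L / N%:R) * W2 x).
    rewrite /m I_cst /I2; under [in LHS]eq_Rintegral do rewrite mul1r.
    by rewrite RintegralZl//; exact: integrableW.
  apply: le_Rintegral => //.
  - exact: (integrable_norm (int2 mfp bfp)).
  - exact: (int2 (measurable_cst _) b1).
  - by move=> x _; rewrite normrM (ger0_norm (W20 x)) ler_wpM2r// close.
have : 2 * L / N%:R * m + 2 * L / N%:R * m <= e.
  have -> : 2 * L / N%:R * m + 2 * L / N%:R * m = (4 * L * m) / N%:R by ring.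
  rewrite ler_pdivrMr ?ltr0n// [leRHS]mulrC -ler_pdivrMr//.
  have h : 0 <= 4 * L * m / e by apply: divr_ge0; [do 2?apply: mulr_ge0|exact: ltW].
  by rewrite (le_trans (ltW (archi_boundP h)))// ler_nat.
apply: le_trans; rewrite (le_trans _ (lerD cl1 cl2))// I_poly.
by rewrite [in leRHS](distrC (I2 f)) (le_trans _ (ler_normD _ _))// addrA subrK.
Unshelve. all: by end_near. Qed.

Lemma moments_unique B : measurable B -> (\int[mu1]_x (\1_B (X1 x) * W1 x)%:E
  = \int[mu2]_x (\1_B (X2 x) * W2 x)%:E)%E.
Proof.
move=> mB; apply: (@weighted_law_unique _ _ _ _ _ _ _ mu1 mu2 X1 X2 W1 W2 _ _ _ _ _ _
  [set A | A = setT \/ RGenCInfty.G A]) => //.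
- rewrite [LHS](RGenCInfty.measurableE R); apply/seteqP; split.
    apply: smallest_sub; first exact: smallest_sigma_algebra.
    by move=> A GA; apply: sub_sigma_algebra; right.
  apply: smallest_sub; first exact: smallest_sigma_algebra.
  by move=> A [->|GA]; [exact: measurableT|exact: sub_sigma_algebra].
- move=> A A' [->|[a ->]] [->|[a' ->]]; rewrite ?setTI ?setIT; first by left.
  + by right; exists a'.
  + by right; exists a.
  + right; exists (Num.max a a'); apply/seteqP; split=> x /=; rewrite !in_itv/= !andbT ge_max.
      by move=> [-> ->].
    by move/andP.
- by left.
move=> _ [->|[a ->]].
  have := moments 0; under eq_integral do rewrite expr0.
  under [in X in _ = X -> _]eq_integral do rewrite expr0.
  move=> h; by under eq_integral do rewrite indicT; under [in RHS]eq_integral do rewrite indicT.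
(* For [n > 0], a ramp rising from 0 at [a - 1/n] to 1 at [a]; these Lipschitz functions converge
   pointwise to the indicator of the closed ray. *)
pose f (n : nat) (x : R) := Num.max 0 (Num.min 1 (1 + n%:R * (x - a))).
have f01 n x : 0 <= f n x <= 1.
  by rewrite /f le_max lexx/= ge_max ler01 ge_min lexx.
have mf n : measurable_fun setT (f n).
  apply: measurable_maxr => //; apply: measurable_minr => //.
  by apply: measurable_funD => //; apply: measurable_funM => //; exact: measurable_funB.
have bf n : bounded (f n).
  by exists 1 => x _; have /andP[f0 f1] := f01 n x; rewrite ger0_norm.
have fE n : I1 (f n) = I2 (f n).
  apply: (@I_lipschitz _ n%:R) => // x y.
  have := clamp_dist (1 + n%:R * (x - a)) (1 + n%:R * (y - a)).
  rewrite (_ : 1 + n%:R * (x - a) - (1 + n%:R * (y - a)) = n%:R * (x - y)); last by ring.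
  by rewrite normrM ger0_norm.
have flim x : f n x @[n --> \oo] --> (\1_`[a, +oo[ x : R).
  rewrite indicE mem_setE in_itv/= andbT; have [ax|xa] := leP a x.
    rewrite (_ : f ^~ x = cst 1); first exact: cvg_cst.
    apply/funext => n; rewrite /f /= min_l ?max_r// lerDl.
    by rewrite mulr_ge0// subr_ge0.
  apply: cvg_near_cst; near=> n.
  rewrite /f max_l// ge_min; apply/orP; right.
  have : (a - x)^-1 <= n%:R.
    by near: n; apply: nbhs_infty_ger.
  rewrite -(ler_pM2r (_ : 0 < a - x)) ?subr_gt0// mulVf; last by rewrite subr_eq0 gt_eqF.
  by rewrite mulrBr; lra.
have conv d (T : measurableType d) (mu : {measure set T -> \bar R}) (X W : T -> R) :
    measurable_fun setT X -> measurable_fun setT W -> (forall x, 0 <= W x) ->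
    (\int[mu]_x (W x)%:E < +oo)%E ->
    (\int[mu]_x (f n (X x) * W x)%:E @[n --> \oo] -->
      \int[mu]_x (\1_`[a, +oo[ (X x) * W x)%:E)%E.
  move=> mX mW W0 fin.
  have [] // := @dominated_convergence _ _ _ mu setT measurableT
    (fun n x => (f n (X x) * W x)%:E) (fun x => (\1_`[a, +oo[ (X x) * W x)%:E)
    (fun x => (W x)%:E).
  - move=> n; apply/measurable_EFinP/measurable_funM => //.
    exact: (measurableT_comp (mf n) mX).
  - apply/measurable_EFinP/measurable_funM => //.
    by apply: (measurableT_comp _ mX); exact: measurable_indic.
  - apply: aeW => x _; apply/fine_cvgP; split; first exact: nearW.
    by apply: cvgMl; exact: flim.
  - exact: integrableW.
  - apply: aeW => x n _; have /andP[f0 f1] := f01 n (X x).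
    by rewrite lee_fin normrM !ger0_norm// ler_piMl.
have c1 := conv _ _ mu1 X1 W1 mX1 mW1 W10 W1fin.
have c2 := conv _ _ mu2 X2 W2 mX2 mW2 W20 W2fin.
rewrite -(cvg_lim _ c1)// -(cvg_lim _ c2)//; congr (limn _).
apply/funext => n; have := fE n; rewrite /I1 /I2 /Rintegral => e.
rewrite -[LHS]fineK ?e ?fineK//; first exact: (integrable_fin_num _ (int2 _ _)).
exact: (integrable_fin_num _ (int1 _ _)).
Unshelve. all: by end_near. Qed.
End MomentUniqueness.

Lemma prod01 (R : numDomainType) (I : Type) (w : seq I) (F : I -> R) :
  (forall i, 0 <= F i <= 1) -> 0 <= \prod_(i <- w) F i <= 1.
Proof.
move=> F01; elim/big_ind: _ => //; first by rewrite ler01 lexx.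
by move=> x y /andP[x0 x1] /andP[y0 y1]; rewrite mulr_ge0//= mulr_ile1.
Qed.

Lemma indic01 (R : numDomainType) (T : Type) (A : set T) x :
  0 <= (\1_A x : R) <= 1.
Proof. by rewrite indicE; case: (_ \in _); rewrite ?lexx ?ler01. Qed.

Definition rectangles d (T : measurableType d) n : set (set (n.-tuple T)) :=
  [set B | exists2 A : 'I_n -> set T, (forall i, measurable (A i)) &
    B = [set t | forall i, A i (tnth t i)]].

Lemma measurable_tuple_rectangles d (T : measurableType d) n :
  @measurable _ (n.-tuple T) = <<s @rectangles _ T n >>.
Proof.
apply/seteqP; split; apply: smallest_sub.
- exact: smallest_sigma_algebra.
- rewrite -bigcup_seq => B [/= i _ [A mA <-]]; rewrite setTI.
  apply: sub_sigma_algebra; exists (fun j => if j == i then A else setT).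
    by move=> j; case: eqP.
  apply/seteqP; split=> t /=; first by move=> At j; case: eqP => // ->.
  by move=> /(_ i); rewrite eqxx.
- exact: sigma_algebra_measurable.
- move=> _ [A mA ->].
  rewrite (_ : [set _ | _] =
      \bigcap_(i in [set: 'I_n]) (fun t => tnth t i) @^-1` A i); last first.
    by apply/seteqP; split=> t /= h i; [move=> _|]; exact: h.
  apply: fin_bigcap_measurable => // i _; rewrite -[X in measurable X]setTI.
  exact: (measurable_tnth i).
Qed.

(** * Moments in several variables *)

Section TupleMoments.
Context {d1 d2 : measure_display} {T1 : measurableType d1}
  {T2 : measurableType d2} {R : realType} {n : nat}
  (mu1 : {measure set T1 -> \bar R}) (mu2 : {measure set T2 -> \bar R}).
Variables (X1 : T1 -> n.-tuple R) (X2 : T2 -> n.-tuple R)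
  (W1 : T1 -> R) (W2 : T2 -> R).
Hypotheses (mX1 : measurable_fun setT X1) (mX2 : measurable_fun setT X2)
  (mW1 : measurable_fun setT W1) (mW2 : measurable_fun setT W2)
  (W10 : forall x, 0 <= W1 x) (W20 : forall x, 0 <= W2 x)
  (X101 : forall x i, 0 <= tnth (X1 x) i <= 1)
  (X201 : forall x i, 0 <= tnth (X2 x) i <= 1)
  (W1fin : (\int[mu1]_x (W1 x)%:E < +oo)%E).
Hypothesis moments : forall w : seq 'I_n,
  (\int[mu1]_x (\prod_(i <- w) tnth (X1 x) i * W1 x)%:E
   = \int[mu2]_x (\prod_(i <- w) tnth (X2 x) i * W2 x)%:E)%E.

Let weight (w : seq 'I_n) (l : seq ('I_n * set R)) (t : n.-tuple R) : R :=
  \prod_(i <- w) tnth t i * \prod_(a <- l) \1_a.2 (tnth t a.1).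

Let mweight w l : (forall a, List.In a l -> measurable a.2) ->
  measurable_fun setT (weight w l).
Proof.
move=> ml; apply: measurable_funM.
  by apply: measurable_prod => i _; exact: measurable_tnth.
elim: l ml => [|a l ih] ml.
  by under eq_fun do rewrite big_nil; exact: measurable_cst.
under eq_fun do rewrite big_cons; apply: measurable_funM.
  have ma : measurable_fun setT (\1_a.2 : R -> R).
    by apply: measurable_indic; apply: ml; left.
  exact: (measurableT_comp ma (measurable_tnth a.1)).
by apply: ih => b bl; apply: ml; right.
Qed.

Let weight01 w l t : (forall i, 0 <= tnth t i <= 1) -> 0 <= weight w l t <= 1.
Proof.
move=> t01; have /andP[a0 a1] := prod01 w t01.
have /andP[b0 b1] := prod01 l (fun a : 'I_n * set R => indic01 R a.2 (tnth t a.1)).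
by rewrite mulr_ge0//= mulr_ile1.
Qed.

(** Induction on the constraints: with everything else in the weight, one-variable uniqueness trades
    the powers of coordinate [i], covered by the induction hypothesis for longer words, for the
    indicator of [A]. *)
Let mixed w l : (forall a, List.In a l -> measurable a.2) ->
  (\int[mu1]_x (weight w l (X1 x) * W1 x)%:E
   = \int[mu2]_x (weight w l (X2 x) * W2 x)%:E)%E.
Proof.
elim: l w => [|[i A] l ih] w ml.
  rewrite /weight; under eq_integral do rewrite big_nil mulr1.
  by under [in RHS]eq_integral do rewrite big_nil mulr1.
have ml' a : List.In a l -> measurable a.2 by move=> al; apply: ml; right.
have e t : weight w ((i, A) :: l) t = \1_A (tnth t i) * weight w l t.
  by rewrite /weight big_cons mulrCA.
under eq_integral do rewrite e -mulrA.
under [in RHS]eq_integral do rewrite e -mulrA.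
apply: (@moments_unique _ _ _ _ _ mu1 mu2 (fun x => tnth (X1 x) i)
  (fun x => tnth (X2 x) i) (fun x => weight w l (X1 x) * W1 x)
  (fun x => weight w l (X2 x) * W2 x)).
- exact: (measurableT_comp (measurable_tnth i) mX1).
- exact: (measurableT_comp (measurable_tnth i) mX2).
- by apply: measurable_funM => //; exact: (measurableT_comp (mweight w ml') mX1).
- by apply: measurable_funM => //; exact: (measurableT_comp (mweight w ml') mX2).
- by move=> x; rewrite mulr_ge0//; have /andP[] := weight01 w l (X101 x).
- by move=> x; rewrite mulr_ge0//; have /andP[] := weight01 w l (X201 x).
- by [].
- by [].
- apply: le_lt_trans W1fin; apply: ge0_le_integral => //.
  + by move=> x _; rewrite lee_fin mulr_ge0//; have /andP[] := weight01 w l (X101 x).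
  + apply/measurable_EFinP/measurable_funM => //.
    exact: (measurableT_comp (mweight w ml') mX1).
  + exact/measurable_EFinP.
  + move=> x _; rewrite lee_fin ler_piMl//.
    by have /andP[] := weight01 w l (X101 x).
- move=> k; have e' t : tnth t i ^+ k * weight w l t = weight (nseq k i ++ w) l t.
    by rewrite /weight big_cat/= big_nseq -Monoid.iteropE mulrA.
  under eq_integral do rewrite mulrA e'.
  under [in RHS]eq_integral do rewrite mulrA e'.
  exact: ih.
- by apply: (ml (i, A)); left.
Qed.

Lemma tuple_moments_unique B : measurable B ->
  (\int[mu1]_x (\1_B (X1 x) * W1 x)%:E = \int[mu2]_x (\1_B (X2 x) * W2 x)%:E)%E.
Proof.
apply: (@weighted_law_unique _ _ _ _ _ _ _ mu1 mu2 X1 X2 W1 W2 _ _ _ _ _ _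
  (@rectangles _ R n)) => //.
- exact: measurable_tuple_rectangles.
- move=> _ _ [A mA ->] [A' mA' ->].
  exists (fun i => A i `&` A' i); first by move=> i; exact: measurableI.
  apply/seteqP; split=> t /=; first by move=> [h h'] i.
  by move=> h; split=> i; have [] := h i.
- by exists (fun=> setT) => //; apply/seteqP; split.
move=> _ [A mA ->].
have e t : (\1_[set t | forall i, A i (tnth t i)] t : R)
    = weight [::] [seq (i, A i) | i <- enum 'I_n] t.
  rewrite /weight big_nil mul1r big_map big_enum/= indicE.
  have [/set_mem h|/negP h] := boolP (t \in _).
    by rewrite big1// => i _; rewrite indicE mem_set.
  have /existsNP[i hi] : ~ forall i, A i (tnth t i) by move=> h'; apply: h; rewrite inE.
  by rewrite (bigD1 i)//= indicE memNset// mul0r.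
under eq_integral do rewrite e.
under [in RHS]eq_integral do rewrite e.
apply: mixed => a.
by elim: (enum 'I_n) => [//|i s ih] /= [<-|]; [exact: mA|exact: ih].
Qed.

End TupleMoments.

(** * Beta and Dirichlet integrals *)

Section Beta.
Variable R : realType.
Notation mu := (@lebesgue_measure R).
Implicit Types a b c : R.

Lemma continuous_powR a x : 0 < x -> {for x, continuous (fun y : R => y `^ a)}.
Proof.
move=> x0; apply/differentiable_continuous/derivable1_diffP.
by apply: derivable_powR; rewrite in_itv/= x0.
Qed.

(* Unlike [powR], which is 1 at negative numbers, this is continuous on the
   whole line for [0 < a]. *)
Definition ppow a (x : R) : R := if 0 < x then x `^ a else 0.

Lemma ppow_gt0 a x : 0 < x -> ppow a x = x `^ a.
Proof. by rewrite /ppow => ->. Qed.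

Lemma ppow_le0 a x : x <= 0 -> ppow a x = 0.
Proof. by rewrite /ppow ltNge => ->. Qed.

Lemma ppow_ge0 a x : 0 <= ppow a x.
Proof. by rewrite /ppow; case: ifP => // _; exact: powR_ge0. Qed.

Lemma ppowS a x : ppow (a + 1) x = x * ppow a x.
Proof.
rewrite /ppow; case: ifPn => [x0|_]; last by rewrite mulr0.
by rewrite powRD ?(gt_eqF x0) ?implybT// powRr1 ?ltW// mulrC.
Qed.

Lemma ppowM a c x : 0 < c -> ppow a (c * x) = c `^ a * ppow a x.
Proof.
move=> c0; rewrite /ppow pmulr_rgt0//; case: ifPn => [x0|_]; last by rewrite mulr0.
by rewrite powRM ?ltW.
Qed.

Lemma continuous_ppow a : 0 < a -> continuous (ppow a).
Proof.
move=> a0 x; have [x0|x0|->] := ltgtP x 0.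
- rewrite /continuous_at (ppow_le0 a (ltW x0)); apply: cvg_near_cst.
  by near=> y; apply/ppow_le0/ltW; near: y; exact: lt_nbhsl.
- apply: (@cvg_trans _ ((fun y => y `^ a) @ x)); last first.
    by rewrite ppow_gt0//; exact: continuous_powR.
  by apply: near_eq_cvg; near=> y; rewrite ppow_gt0//; near: y; exact: lt_nbhsr.
- apply/left_right_continuousP; split.
    rewrite ppow_le0//; apply: cvg_near_cst; near=> y.
    by rewrite ppow_le0.
  rewrite ppow_le0//; apply: cvg_trans (powR_cvg0 a0).
  by apply: near_eq_cvg; near=> y; rewrite ppow_gt0.
Unshelve. all: by end_near. Qed.

Lemma is_derive_ppow a (x : R) : 0 < x -> is_derive x 1 (ppow (a + 1)) ((a + 1) * ppow a x).
Proof.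
move=> x0; have := @is_derive1_powR R (a + 1) x x0; rewrite addrK ppow_gt0//.
apply: near_eq_is_derive => //.
by near=> y; rewrite ppow_gt0//; near: y; exact: lt_nbhsr.
Unshelve. all: by end_near. Qed.

(** Euler's B(a + 1, b + 1); for positive [a] and [b] the integrand is continuous. *)
Definition beta a b : R := \int[mu]_(x in `[0, 1]) (ppow a x * ppow b (1 - x)).

Lemma continuous_ppow_sub a c : 0 < a -> continuous (fun x => ppow a (c - x)).
Proof.
move=> a0 x; have h : {for x, continuous (ppow a \o (fun y => c - y))}.
  apply: continuous_comp; last exact: continuous_ppow.
  by apply: continuousB => //; exact: cvg_cst.
exact: h.
Qed.

Lemma continuous_beta_integrand a b c : 0 < a -> 0 < b ->
  continuous (fun x : R => ppow a x * ppow b (c - x)).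
Proof.
move=> a0 b0 x; apply: cvgM; first exact: continuous_ppow.
exact: continuous_ppow_sub.
Qed.

Lemma integrable_beta a b : 0 < a -> 0 < b ->
  mu.-integrable `[0, 1] (EFin \o (fun x : R => ppow a x * ppow b (1 - x))).
Proof.
move=> a0 b0; apply: continuous_compact_integrable; first exact: segment_compact.
by apply: continuous_subspaceT; exact: continuous_beta_integrand.
Qed.

Lemma betaD a b : 0 < a -> 0 < b -> beta (a + 1) b + beta a (b + 1) = beta a b.
Proof.
move=> a0 b0; rewrite /beta -RintegralD//; last 2 first.
- by apply: integrable_beta => //; rewrite addr_gt0.
- by apply: integrable_beta => //; rewrite addr_gt0.
by apply: eq_Rintegral => x _; rewrite !ppowS; ring.
Qed.

(** Integration by parts for [x^(a+1) (1-x)^(b+1)], which vanishes at both ends. *)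
Lemma beta_parts a b : 0 < a -> 0 < b ->
  (a + 1) * beta a (b + 1) = (b + 1) * beta (a + 1) b.
Proof.
move=> a0 b0.
have a1 : 0 < a + 1 by rewrite addr_gt0.
have b1 : 0 < b + 1 by rewrite addr_gt0.
pose G (x : R) := ppow (b + 1) (1 - x); pose g (x : R) := - ((b + 1) * ppow b (1 - x)).
have cB d : 0 < d -> continuous (fun x : R => ppow d (1 - x)).
  exact: continuous_ppow_sub.
have dG (x : R) : x \in `]0, 1[ -> is_derive x 1 G (g x).
  rewrite in_itv/= => /andP[_ x1].
  have s0 : 0 < 1 - x by rewrite subr_gt0.
  have h1 := @is_derive_ppow b (1 - x) s0.
  have h2 : is_derive x 1 (fun x : R => 1 - x) (-1).
    by rewrite -[X in is_derive _ _ _ X]add0r; exact: is_deriveB.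
  have := @is_derive1_comp _ _ (fun x : R => 1 - x) _ _ _ h1 h2.
  by rewrite /g mulrN1.
have dF (x : R) : x \in `]0, 1[ -> is_derive x 1 (ppow (a + 1)) ((a + 1) * ppow a x).
  by rewrite in_itv/= => /andP[x0 _]; exact: is_derive_ppow.
have := @Rintegration_by_parts R (ppow (a + 1)) G (fun x => (a + 1) * ppow a x) g 0 1 ltr01.
have -> : G 1 = 0 by rewrite /G subrr ppow_le0.
rewrite (ppow_le0 (a + 1) (lexx 0)) mulr0 mul0r subrr sub0r.
have -> : \int[mu]_(x in `[0, 1]) (ppow (a + 1) x * g x) = - ((b + 1) * beta (a + 1) b).
  rewrite /beta -mulNr -RintegralZl//; last exact: integrable_beta.
  by apply: eq_Rintegral => x _; rewrite /g; ring.
have -> : \int[mu]_(x in `[0, 1]) ((a + 1) * ppow a x * G x) = (a + 1) * beta a (b + 1).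
  rewrite /beta -RintegralZl//; last exact: integrable_beta.
  by apply: eq_Rintegral => x _; rewrite mulrA.
move=> h; apply: oppr_inj; rewrite -h; first reflexivity.
- apply: continuous_subspaceT => x; apply: cvgM; first exact: cvg_cst.
  exact: continuous_ppow.
- split.
  + by move=> x /dF; case.
  + by apply: cvg_at_right_filter; exact: continuous_ppow.
  + by apply: cvg_at_left_filter; exact: continuous_ppow.
- by move=> x /dF dFx; rewrite derive1E derive_val.
- apply: continuous_subspaceT => x; apply: cvgN; apply: cvgM; first exact: cvg_cst.
  exact: cB.
- split.
  + by move=> x /dG; case.
  + by apply: cvg_at_right_filter; exact: cB.
  + by apply: cvg_at_left_filter; exact: cB.
- by move=> x /dG dGx; rewrite derive1E derive_val.
Qed.

Lemma beta_gt0 a b : 0 < a -> 0 < b -> 0 < beta a b.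
Proof.
move=> a0 b0; have ge0 x : 0 <= ppow a x * ppow b (1 - x).
  by rewrite mulr_ge0 ?ppow_ge0.
(* On [1/4, 3/4] the integrand is at least [(1/4)^a (1/4)^b]. *)
have q0 : 0 < 4^-1 :> R by rewrite invr_gt0.
set m := 4^-1 `^ a * 4^-1 `^ b.
have m0 : 0 < m by rewrite mulr_gt0 ?powR_gt0.
have h3 : 4^-1 <= 1 - 4^-1 :> R by lra.
have : \int[mu]_(x in `[4^-1, 1 - 4^-1]) m <= beta a b.
  rewrite /beta Rintegral_mkcond [leRHS]Rintegral_mkcond; apply: le_Rintegral => //.
  - rewrite -restrict_EFin; apply: (iffLR (integrable_mkcond _ _)) => //.
    apply: continuous_compact_integrable; first exact: segment_compact.
    by apply: continuous_subspaceT => x; exact: cvg_cst.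
  - by rewrite -restrict_EFin; apply: (iffLR (integrable_mkcond _ _)) => //; exact: integrable_beta.
  move=> x _; rewrite !patchE; case: ifPn => [|_]; last by case: ifPn.
  rewrite inE /= in_itv/= => /andP[x1 x2]; rewrite mem_set; last first.
    by rewrite /= in_itv/=; apply/andP; split; lra.
  rewrite !ppow_gt0; [|lra|lra].
  rewrite ler_pM ?powR_ge0// ge0_ler_powR ?nnegrE//; try exact: ltW; lra.
apply: lt_le_trans; rewrite Rintegral_cst//= lebesgue_measure_itv/= lte_fin.
case: ifPn; last by rewrite -leNgt; lra.
by move=> _; rewrite mulr_gt0//= ; lra.
Qed.

(** [betaD] and [beta_parts] are two linear equations for the two raised integrals; solving them
    bypasses the Gamma function. *)
Lemma beta_succl a b : 0 < a -> 0 < b ->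
  beta (a + 1) b * (a + b + 2) = (a + 1) * beta a b.
Proof.
move=> a0 b0; have := betaD a0 b0; have := beta_parts a0 b0 => h <-.
by rewrite [RHS]mulrDr h; ring.
Qed.

Lemma beta_succr a b : 0 < a -> 0 < b ->
  beta a (b + 1) * (a + b + 2) = (b + 1) * beta a b.
Proof.
move=> a0 b0; have := betaD a0 b0; have := beta_parts a0 b0 => h <-.
by rewrite [RHS]mulrDr -h; ring.
Qed.

Lemma integral_beta_scaled k a b c : 0 <= k -> 0 < a -> 0 < b -> 0 < c ->
  (\int[mu]_x (k * ppow a x * ppow b (c - x))%:E
   = (k * beta a b * c `^ (a + b + 1))%:E)%E.
Proof.
move=> k0 a0 b0 c0.
(* [ppow] vanishes at nonpositive arguments, so the integrand is supported in [0, c]; scaling by [c]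
   then gives one power of [c] per exponent and one for the differential. *)
transitivity (\int[mu]_(x in `[0%R, c]) (k * (ppow a x * ppow b (c - x)))%:E)%E.
  rewrite [RHS]integral_mkcond; apply: eq_integral => x _.
  rewrite patchE; case: ifPn => [_|]; first by rewrite mulrA.
  rewrite notin_setE /= in_itv/= => /negP; rewrite negb_and -!ltNge.
  case/orP => h; first by rewrite (ppow_le0 a (ltW h)) mulr0 mul0r.
  by rewrite (ppow_le0 b (_ : c - x <= 0)) ?mulr0// subr_le0 ltW.
have := @integration_by_substitution_increasing R (fun x => c * x)
  (fun x => k * (ppow a x * ppow b (c - x))) 0 1 ler01.
have dc (x : R) : is_derive x 1 (fun x : R => c * x) c.
  by rewrite -[X in is_derive _ _ _ X]mulr1; exact: is_deriveZ.
have dE : derive1 (fun x : R => c * x) = cst c.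
  by apply/funext => x; rewrite derive1E derive_val.
have cc : continuous (fun x : R => c * x) by move=> x; apply: cvgM => //; exact: cvg_cst.
rewrite mulr0 mulr1 dE => ->; last first.
- apply: continuous_subspaceT => x; apply: cvgM; first exact: cvg_cst.
  exact: continuous_beta_integrand.
- split; first by move=> x _; case: (dc x).
  + by apply: cvg_at_right_filter; exact: cc.
  + by apply: cvg_at_left_filter; exact: cc.
- exact: is_cvg_cst.
- exact: is_cvg_cst.
- by move=> x _; exact: cvg_cst.
- by move=> x y _ _ xy; rewrite ltr_pM2l.
have e x : k * (ppow a (c * x) * ppow b (c - c * x)) * c
    = k * c `^ (a + b + 1) * (ppow a x * ppow b (1 - x)).
  rewrite (_ : c - c * x = c * (1 - x)); last by ring.
  rewrite !ppowM// !powRD ?(gt_eqF c0) ?implybT// powRr1 ?ltW//; ring.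
transitivity (\int[mu]_(x in `[0%R, 1%R])
    ((k * c `^ (a + b + 1))%:E * (ppow a x * ppow b (1 - x))%:E))%E.
  by apply: eq_integral => x _; rewrite -EFinM -e.
rewrite integralZl//; last exact: integrable_beta.
rewrite -[X in (_ * X)%E]fineK; last exact: integrable_fin_num (integrable_beta a0 b0).
by rewrite -EFinM; congr EFin; rewrite -/(Rintegral _ _ _) -/(beta a b); ring.
Qed.
End Beta.

Section DirichletIntegral.
Variable R : realType.
Implicit Types (b : nat -> R) (c k : R).

(* Here the exponents are [b i], not [b i - 1]: over the simplex of size [c],
   \prod_i y_i ^ b_i integrates to [dirichlet_mass n b] times [c] to the power
   [dirichlet_degree n b]. *)
Fixpoint dirichlet_degree n b : R :=
  if n is n'.+1 then b 0%N + dirichlet_degree n' (b \o S) + 1 else b 0%N.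

Fixpoint dirichlet_mass n b : R :=
  if n is n'.+1 then
    beta (b 0%N) (dirichlet_degree n' (b \o S)) * dirichlet_mass n' (b \o S)
  else 1.

Lemma dirichlet_degreeE n b :
  dirichlet_degree n b = \sum_(i < n.+1) b i + n%:R.
Proof.
elim: n b => [|n ih] b /=; first by rewrite big_ord1 addr0.
by rewrite ih [in RHS]big_ord_recl -natr1 -!addrA.
Qed.

Lemma dirichlet_degree_gt0 n b : (forall i, 0 < b i) -> 0 < dirichlet_degree n b.
Proof.
elim: n b => [|n ih] b b0 //=; have := ih (b \o S) (fun i => b0 i.+1) => d0.
by rewrite addr_gt0// addr_gt0.
Qed.

Lemma dirichlet_mass_gt0 n b : (forall i, 0 < b i) -> 0 < dirichlet_mass n b.
Proof.
elim: n b => [|n ih] b b0 //=.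
have b0' i : 0 < (b \o S) i by exact: b0.
by rewrite mulr_gt0 ?ih// beta_gt0// dirichlet_degree_gt0.
Qed.

Let incr b j : nat -> R := fun i => b i + (i == j)%:R.

Let incrS b j : incr b j.+1 \o S = incr (b \o S) j.
Proof. by apply/funext => i; rewrite /incr /= eqSS. Qed.

Let incr0 b : incr b 0 \o S = b \o S.
Proof. by apply/funext => i; rewrite /incr /= addr0. Qed.

Let degree_incr n b j : (j <= n)%N ->
  dirichlet_degree n (incr b j) = dirichlet_degree n b + 1.
Proof.
elim: n b j => [|n ih] b [|j] //= jn; first by rewrite incr0 /incr eqxx /=; ring.
by rewrite incrS ih// /incr /=; ring.
Qed.

(** The moment recursion for parameters [b i + 1], whose sum is [dirichlet_degree n b + 1]. Raising
    a tail exponent raises the tail degree as well, so [beta_succr] enters besides the tail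
    recursion. *)
Lemma dirichlet_mass_incr n b j : (forall i, 0 < b i) -> (j <= n)%N ->
  dirichlet_mass n (fun i => b i + (i == j)%:R) * (dirichlet_degree n b + 1)
  = (b j + 1) * dirichlet_mass n b.
Proof.
rewrite -/(incr b j).
elim: n b j => [|n ih] b [|j] //= b0 jn; first by rewrite mul1r mulr1.
  rewrite incr0 /incr eqxx /=; set s := dirichlet_degree n _.
  have s0 : 0 < s by apply: dirichlet_degree_gt0 => i; exact: b0.
  have := beta_succl (b0 0%N) s0 => h.
  by rewrite mulrA -h; ring.
have b0' i : 0 < (b \o S) i by exact: b0.
have -> : incr b j.+1 0%N = b 0%N by rewrite /incr /= addr0.
rewrite incrS degree_incr//.
have := ih _ _ b0' jn; have := beta_succr (b0 0%N) (dirichlet_degree_gt0 n b0').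
set s := dirichlet_degree n _; set D := dirichlet_mass n _.
set D' := dirichlet_mass n _; set B := beta _ _; set B' := beta _ _ => h1 h2.
have s0 : s + 1 != 0 by rewrite lt0r_neq0// addr_gt0// dirichlet_degree_gt0.
apply: (mulIf s0).
transitivity ((B * (b 0%N + s + 2)) * (D * (s + 1))); first by ring.
by rewrite h1 h2 /=; ring.
Qed.

Lemma iterated_integral0 n :
  iterated_integral (fun _ : n.-tuple R => 0%E) = 0%E.
Proof.
elim: n => [//|n ih] /=; under eq_integral do rewrite ih.
exact: integral0.
Qed.

Lemma tnth_cons_lift (A : Type) n (x : A) (u : n.-tuple A) i :
  tnth (cons_tuple x u) (lift ord0 i) = tnth u i.
Proof. by rewrite !(tnth_nth x). Qed.

Lemma complete_cons n x (u : n.-tuple R) c :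
  c - \sum_(i < n.+1) tnth (cons_tuple x u) i = (c - x) - \sum_(i < n) tnth u i.
Proof.
rewrite big_ord_recl opprD addrA; congr (_ - _ - _).
by apply: eq_bigr => i _; rewrite tnth_cons_lift.
Qed.

(** The size [c] and the factor [k] are free for the induction: fixing the first coordinate [x]
    leaves a simplex of size [c - x] and multiplies [k] by [ppow (b 0) x]. *)
Lemma iterated_integral_dirichlet n b c k : (forall i, 0 < b i) -> 0 <= k ->
  iterated_integral (fun t : n.-tuple R => (k *
    \prod_(i < n.+1) ppow (b i) (nth 0 (rcons t (c - \sum_(i < n) tnth t i)) i))%:E)
  = (k * dirichlet_mass n b * ppow (dirichlet_degree n b) c)%:E.
Proof.
elim: n b c k => [|n ih] b c k b0 k0 /=.
  by rewrite big_ord1 /= big_ord0 subr0 mulr1.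
have b0' i : 0 < (b \o S) i by exact: b0.
set s := dirichlet_degree n _; set D := dirichlet_mass n _.
have s0 : 0 < s by exact: dirichlet_degree_gt0.
have D0 : 0 <= D by apply/ltW; exact: dirichlet_mass_gt0.
transitivity (\int[@lebesgue_measure R]_x
    (k * D * ppow (b 0%N) x * ppow s (c - x))%:E)%E.
  apply: eq_integral => x _.
  rewrite (_ : k * D * ppow (b 0%N) x * ppow s (c - x)
    = (k * ppow (b 0%N) x) * D * ppow s (c - x)); last by ring.
  rewrite -ih ?mulr_ge0 ?ppow_ge0//; congr iterated_integral.
  apply/funext => u; rewrite complete_cons.
  rewrite [X in (k * X)%:E]big_ord_recl /= mulrA.
  by congr (_ * _)%:E; apply: eq_bigr.
have [c0|c0] := leP c 0.
  rewrite ppow_le0// mulr0; under eq_integral => x _.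
    rewrite (_ : _ * _ = 0); last first.
      have [x0|x0] := leP x 0; first by rewrite (ppow_le0 _ x0) mulr0 mul0r.
      by rewrite (ppow_le0 s) ?mulr0//; lra.
    over.
  exact: integral0.
rewrite integral_beta_scaled// ?mulr_ge0// ppow_gt0//; congr EFin; ring.
Qed.

(** For functions vanishing off the unit cube, each Lebesgue integral may be taken against the
    uniform law on [0, 1]. The product law is a genuine measure on tuples, open to uniqueness
    theorems. *)
Lemma iterated_integral_probability n :
  exists lam : probability (n.-tuple R) R, forall f : n.-tuple R -> \bar R,
    measurable_fun setT f -> (forall t, 0 <= f t)%E ->
    (forall t i, ~~ (0 <= tnth t i <= 1) -> f t = 0%E) ->
    iterated_integral f = (\int[lam]_t f t)%E.
Proof.
elim: n => [|n [lam lamE]].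
  exists (dirac [tuple]) => f mf f0 _ /=.
  by rewrite integral_dirac// diracT mul1e.
pose h (z : R * n.-tuple R) : n.+1.-tuple R := cons_tuple z.1 z.2.
have mh : measurable_fun setT h by apply: measurable_cons.
(* The image under the identity carries the uniform law from [measurableTypeR R] to the type of the
   tuple entries. *)
have mid : measurable_fun setT
  (id : measurableTypeR R -> R) by move=> _ B mB; rewrite setTI.
pose U : probability R R := distribution (uniform_prob (@ltr01 R))
  (HB.pack (id : measurableTypeR R -> R) (isMeasurableFun.Build _ _ _ _ _ mid)).
pose H : {mfun (R * n.-tuple R)%type >-> n.+1.-tuple R} :=
  HB.pack h (isMeasurableFun.Build _ _ _ _ _ mh).
exists (distribution (U \x lam)%E H) => f mf f0 f01.
rewrite ge0_integral_pushforward//.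
rewrite preimage_setT.
have mfh : measurable_fun setT (f \o h) by exact: (measurableT_comp mf mh).
rewrite (fubini_tonelli1 _ mfh); last by move=> z; exact: f0.
have mF : measurable_fun setT (fun x => \int[lam]_u f (cons_tuple x u))%E.
  by apply: (measurable_fun_fubini_tonelli_F _ mfh) => z; exact: f0.
have F0 x : (0 <= \int[lam]_u f (cons_tuple x u))%E by apply: integral_ge0.
transitivity (\int[U]_x (\int[lam]_u f (cons_tuple x u)))%E; last by [].
rewrite ge0_integral_pushforward//.
rewrite preimage_setT integral_uniform//.
rewrite subr0 invr1 mul1e /= [RHS]integral_mkcond; apply: eq_integral => x _.
rewrite patchE; case: ifPn => [_|].
  rewrite lamE//.
  - exact: (@measurable_fun_pair2 _ _ _ _ _ _ _ (x : R) mfh).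
  - move=> t i ti; apply: (f01 _ (lift ord0 i)).
    by rewrite tnth_cons_lift.
rewrite notin_setE /= in_itv/= => /negP x01.
rewrite (_ : (fun _ => _) = fun=> 0%E) ?iterated_integral0//.
by apply/funext => t; apply: (f01 _ ord0).
Qed.

End DirichletIntegral.

(** * Dirichlet laws from moments *)

Section Moments.
Context {d : measure_display} {Omega : measurableType d} {R : realType}
  (P : probability Omega R).

Definition bounded_measurable (f : Omega -> R) : Prop :=
  measurable_fun setT f /\ exists C, forall x, `|f x| <= C.

Lemma bounded_measurable_integrable (f : Omega -> R) : bounded_measurable f ->
  P.-integrable setT (EFin \o f).
Proof.
move=> [mf [C fC]]; apply: measurable_bounded_integrable => //.
  by rewrite -ge0_fin_numE ?fin_num_measure.
exists C; split; first by rewrite num_real.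
by move=> y Cy x _ /=; rewrite (le_trans (fC x))// ltW.
Qed.

Lemma bounded_measurableM (f g : Omega -> R) : bounded_measurable f -> bounded_measurable g ->
  bounded_measurable (fun x => f x * g x).
Proof.
move=> [mf [C fC]] [mg [D gD]]; split; first exact: measurable_funM.
by exists (C * D) => x; rewrite normrM ler_pM.
Qed.

Lemma bounded_measurable01 (f : Omega -> R) : measurable_fun setT f ->
  (forall x, 0 <= f x <= 1) -> bounded_measurable f.
Proof.
by move=> mf f01; split=> //; exists 1 => x; have /andP[f0 f1] := f01 x; rewrite ger0_norm.
Qed.

Lemma bounded_measurable_cst (c : R) : bounded_measurable (fun=> c).
Proof. by split=> //; exists `|c|. Qed.

Lemma bounded_measurable_prod (I : Type) (w : seq I) (f : I -> Omega -> R) :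
  (forall i, bounded_measurable (f i)) ->
  bounded_measurable (fun x => \prod_(i <- w) f i x).
Proof.
move=> bf; elim: w => [|i w ih].
  by under eq_fun do rewrite big_nil; exact: bounded_measurable_cst.
by under eq_fun do rewrite big_cons; exact: bounded_measurableM.
Qed.

Lemma bounded_measurable_sum (I : Type) (w : seq I) (p : pred I) (f : I -> Omega -> R) :
  (forall i, bounded_measurable (f i)) ->
  bounded_measurable (fun x => \sum_(i <- w | p i) f i x).
Proof.
move=> bf; elim: w => [|i w ih].
  by under eq_fun do rewrite big_nil; exact: bounded_measurable_cst.
under eq_fun do rewrite big_cons; case: (p i) => //.
have [[mf [C fC]] [mg [D gD]]] := (bf i, ih); split; first exact: measurable_funD.
by exists (C + D) => x; rewrite (le_trans (ler_normD _ _))// lerD.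
Qed.

Lemma EFin_Rintegral (f : Omega -> R) : bounded_measurable f ->
  (\int[P]_x f x)%:E = (\int[P]_x (f x)%:E)%E.
Proof.
move=> /bounded_measurable_integrable bf.
by rewrite /Rintegral fineK//; exact: integrable_fin_num.
Qed.

Lemma Rintegral_bounded_sum (I : Type) (w : seq I) (p : pred I) (f : I -> Omega -> R) :
  (forall i, bounded_measurable (f i)) ->
  \int[P]_x (\sum_(i <- w | p i) f i x) = \sum_(i <- w | p i) \int[P]_x f i x.
Proof.
move=> bf; elim: w => [|i w ih].
  under eq_Rintegral do rewrite big_nil.
  by rewrite big_nil /Rintegral integral0.
rewrite big_cons -ih; under eq_Rintegral do rewrite big_cons.
case: (p i) => //; rewrite RintegralD//; apply: bounded_measurable_integrable => //.
exact: bounded_measurable_sum.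
Qed.

Lemma Rintegral_gt0 (f : Omega -> R) : bounded_measurable f ->
  (forall x, 0 < f x) -> 0 < \int[P]_x f x.
Proof.
move=> bf f0; rewrite lt0r Rintegral_ge0 ?andbT; last by move=> x _; exact: ltW.
apply/eqP => h; have := EFin_Rintegral bf; rewrite h => h'.
have mf : measurable_fun setT (EFin \o f) by apply/measurable_EFinP; exact: (proj1 bf).
have [ae _] := ae_eq_integral_abs P measurableT mf.
have [|N [mN N0 sub]] := ae.
  rewrite (eq_integral (EFin \o f)) => [|x _]; first exact: esym h'.
  by rewrite /= ger0_norm// ltW.
have : (P setT <= P N)%E.
  apply: le_measure; rewrite ?inE// => x _; apply: sub => /= /(_ I) /eqP.
  by rewrite eqe gt_eqF.
by rewrite N0 probability_setT leNgt lte01.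
Qed.

Definition moment (J : Type) (X : J -> Omega -> R) (w : seq J) : R :=
  \int[P]_x \prod_(i <- w) X i x.

(** The predictive rule of Polya's urn: after the word [w], letter [j] has probability (alpha_j +
    its count) / (|alpha| + length). *)
Definition dirichlet_moments (J : finType) (X : J -> Omega -> R) (alpha : J -> R) :=
  forall j w, moment X (j :: w) * (\sum_i alpha i + (size w)%:R)
    = (alpha j + (count_mem j w)%:R) * moment X w.

End Moments.

Section DirichletLaw.
Context {d : measure_display} {Omega : measurableType d} {R : realType}
  (P : probability Omega R) (n : nat).
Variables (X : 'I_n.+1 -> Omega -> R) (alpha : 'I_n.+1 -> R).
Hypotheses (mX : forall i, measurable_fun setT (X i))
  (X0 : forall i x, 0 < X i x) (X1 : forall x, \sum_i X i x = 1)
  (alpha0 : forall i, 0 < alpha i) (rec : dirichlet_moments P X alpha).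

Let X01 i x : 0 <= X i x <= 1.
Proof.
rewrite ltW//= -(X1 x) (bigD1 i)//= lerDl.
by apply: sumr_ge0 => j _; exact: ltW.
Qed.

Let bX i : bounded_measurable (X i). Proof. exact: bounded_measurable01. Qed.

Let Xt x : n.+1.-tuple R := [tuple X i x | i < n.+1].
(* Weighting the law of [X] by the product of its entries raises every Dirichlet
   parameter by 1, so that the density becomes bounded and continuous. *)
Let W1 x := \prod_i X i x.

Let mXt : measurable_fun setT Xt.
Proof.
apply/measurable_fun_tnthP => i; rewrite (_ : _ \o _ = X i)//.
by apply/funext => x /=; rewrite tnth_mktuple.
Qed.

Let bW1 : bounded_measurable W1. Proof. exact: bounded_measurable_prod. Qed.

Let W1_gt0 x : 0 < W1 x. Proof. exact: prodr_gt0. Qed.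

(** [inord] sends indices above [n] to 0, so [b] is positive at every natural number. *)
Let b (i : nat) : R := alpha (inord i).
Let b0 i : 0 < b i. Proof. exact: alpha0. Qed.

(** Weighting turns the exponent [alpha i - 1] into [alpha i], and each letter [i] of [w] adds 1. *)
Let bw (w : seq 'I_n.+1) (i : nat) : R :=
  b i + (count (fun j : 'I_n.+1 => i == j) w)%:R.

Let bw0 w i : 0 < bw w i. Proof. by rewrite ltr_wpDr. Qed.

Let y (t : n.-tuple R) := complete_to_one t.

Let K w t := \prod_(i < n.+1) ppow (bw w i) (tnth (y t) i).

Let K_cons j w t : K (j :: w) t = tnth (y t) j * K w t.
Proof.
rewrite /K (bigD1 j)//= [in RHS](bigD1 j)//= mulrA; congr (_ * _).
  by rewrite {1}/bw /= eqxx natrD addrCA addrC ppowS.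
apply: eq_bigr => i ij; rewrite /bw /= (_ : (i == j :> nat) = false) ?add0n//.
exact/negbTE.
Qed.

Let K_ge0 w t : 0 <= K w t.
Proof. by apply: prodr_ge0 => i _; exact: ppow_ge0. Qed.

Let K_prod w t : K w t = \prod_(i <- w) tnth (y t) i * K [::] t.
Proof.
by elim: w => [|j w ih]; rewrite ?big_nil ?mul1r// big_cons K_cons ih mulrA.
Qed.

Let y_sum t : \sum_i tnth (y t) i = 1.
Proof.
rewrite big_ord_recr /=.
rewrite (eq_bigr (tnth t)) => [|i _].
  rewrite (tnth_nth 0)/= nth_rcons size_tuple ltnn eqxx; ring.
by rewrite !(tnth_nth 0)/= nth_rcons size_tuple ltn_ord.
Qed.

Let K_supp w t : K w t != 0 -> forall i, 0 < tnth (y t) i <= 1.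
Proof.
move=> K0; have y0 i : 0 < tnth (y t) i.
  rewrite ltNge; apply: contraNN K0 => yi.
  by rewrite /K (bigD1 i)//= ppow_le0// mul0r.
move=> i; rewrite y0/= -(y_sum t) (bigD1 i)//= lerDl.
by apply: sumr_ge0 => j _; exact: ltW.
Qed.

Let my i : measurable_fun setT (fun t : n.-tuple R => tnth (y t) i).
Proof.
have [ni|ni] := ltnP i n.
  rewrite (_ : (fun _ => _) = (fun t => tnth t (Ordinal ni))).
    exact: measurable_tnth.
  by apply/funext => t; rewrite !(tnth_nth 0)/= nth_rcons size_tuple ni.
rewrite (_ : (fun _ => _) = (fun t => 1 - \sum_(j < n) tnth t j)).
  apply: measurable_funB => //; apply: measurable_sum => j.
  exact: measurable_tnth.
apply/funext => t; rewrite (tnth_nth 0)/= nth_rcons size_tuple ltnNge ni/=.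
by rewrite (_ : _ == n)// eqn_leq ni andbT -ltnS.
Qed.

Let mK w : measurable_fun setT (K w).
Proof.
apply: measurable_prod => i _; apply: (measurableT_comp _ (my i)).
apply: continuous_measurable_fun; exact: continuous_ppow.
Qed.

Let K_zero w t i : ~~ (0 <= tnth t i <= 1) -> K w t = 0.
Proof.
apply: contraNeq => /K_supp /(_ (widen_ord (leqnSn n) i)).
rewrite !(tnth_nth 0)/= nth_rcons size_tuple ltn_ord.
by move=> /andP[/ltW -> ->].
Qed.

Let c := (\int[P]_x W1 x) / dirichlet_mass n b.

(** Both sides obey one recursion in [w], by [rec] and by [dirichlet_mass_incr]. Appending every
    letter once accounts for the weight [W1], and [c] makes the empty word agree. *)
Let mass_moment w : moment P X (w ++ enum 'I_n.+1) = c * dirichlet_mass n (bw w).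
Proof.
elim: w => [|j w ih].
  have -> : bw [::] = b by apply/funext => i; rewrite /bw addr0.
  rewrite /c divfK ?gt_eqF ?dirichlet_mass_gt0//.
  by rewrite /moment; apply: eq_Rintegral => x _; rewrite /= big_enum.
have := rec j (w ++ enum 'I_n.+1).
rewrite cat_cons -/(moment _ _ _) ih size_cat count_cat.
have -> : count_mem j (enum 'I_n.+1) = 1%N by rewrite count_uniq_mem ?enum_uniq ?mem_enum.
rewrite size_enum_ord => h.
have := @dirichlet_mass_incr R n (bw w) j (bw0 w) (ltn_ord j).
have -> : (fun i => bw w i + (i == j)%:R) = bw (j :: w).
  by apply/funext => i; rewrite /bw /= natrD; ring.
have -> : dirichlet_degree n (bw w) + 1 = \sum_i alpha i + (size w + n.+1)%:R.
  rewrite dirichlet_degreeE /bw big_split/= -natr_sum.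
  have -> : \sum_(i < n.+1) b i = \sum_i alpha i.
    by apply: eq_bigr => i _; rewrite /b inord_val.
  have -> : (\sum_(i < n.+1) count (fun j : 'I_n.+1 => i == j :> nat) w = size w)%N.
    elim: w {ih h} => [|k w ih] /=; first by rewrite big1.
    rewrite big_split/= ih (bigD1 k)//= eqxx big1 ?addn0 ?add1n//.
    by move=> i ik; rewrite (_ : (i == k :> nat) = false)//; exact/negbTE.
  by rewrite natrD -[in RHS]natr1; ring.
have -> : bw w j = alpha j + (count_mem j w)%:R.
  rewrite /bw /b inord_val; congr (_ + _%:R); apply: eq_count => i.
  by rewrite /= eq_sym.
set S := \sum_i alpha i + _ => h'.
have S0 : S != 0.
  rewrite gt_eqF// ltr_wpDr// (bigD1 j)//= ltr_wpDr//.
  by apply: sumr_ge0 => i _; exact: ltW.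
apply: (mulIf S0); rewrite h -(mulrA c _ S) h' natrD; ring.
Qed.

(** Off the simplex the entries of [y t] can leave [0, 1], which moment uniqueness does not allow;
    clipping changes them only where [K [::]] vanishes. *)
Let clip (u : R) := Num.max 0 (Num.min 1 u).
Let X2 (t : n.-tuple R) : n.+1.-tuple R := [tuple clip (tnth (y t) i) | i < n.+1].
Let W2 t := c * K [::] t.

Let clip01 u : 0 <= clip u <= 1.
Proof. by rewrite /clip le_max lexx/= ge_max ler01 ge_min lexx. Qed.

Let clip_id u : 0 < u <= 1 -> clip u = u.
Proof. by move=> /andP[u0 u1]; rewrite /clip min_r// max_r// ltW. Qed.

Let X2E t : K [::] t != 0 -> X2 t = y t.
Proof.
move=> /K_supp ys; apply: eq_from_tnth => i.
by rewrite tnth_mktuple clip_id.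
Qed.

Let mX2 : measurable_fun setT X2.
Proof.
apply/measurable_fun_tnthP => i.
rewrite (_ : _ \o _ = (fun t => clip (tnth (y t) i))); last first.
  by apply/funext => t /=; rewrite tnth_mktuple.
by apply: measurable_maxr => //; apply: measurable_minr.
Qed.

Let c_gt0 : 0 < c.
Proof.
by rewrite divr_gt0 ?dirichlet_mass_gt0// Rintegral_gt0.
Qed.

Lemma dirichlet_law_of_moments B : measurable B ->
  P [set x | B [tuple X i x | i < n.+1]] = dirichlet_law alpha B.
Proof.
move=> mB; have [lam lamE] := iterated_integral_probability R n.
have mW2 : measurable_fun setT W2 by exact: measurable_funM.
have W20 t : 0 <= W2 t by rewrite mulr_ge0// ltW.
have eqB : forall B : set (n.+1.-tuple R), measurable B ->
  (\int[P]_x (\1_B (Xt x) * W1 x)%:E = \int[lam]_t (\1_B (X2 t) * W2 t)%:E)%E.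
  apply: tuple_moments_unique => //.
  - exact: (proj1 bW1).
  - by move=> x; exact: ltW.
  - by move=> x i; rewrite tnth_mktuple.
  - by move=> t i; rewrite tnth_mktuple.
  - by rewrite -EFin_Rintegral// ltry.
  move=> w.
  have bm : bounded_measurable (fun x => \prod_(i <- w ++ enum 'I_n.+1) X i x).
    exact: bounded_measurable_prod.
  transitivity (moment P X (w ++ enum 'I_n.+1))%:E.
    rewrite EFin_Rintegral//; apply: eq_integral => x _; congr EFin.
    rewrite big_cat/= big_enum/=; congr (_ * _); apply: eq_bigr => i _.
    by rewrite tnth_mktuple.
  rewrite mass_moment; transitivity (\int[lam]_t (c * K w t)%:E)%E; last first.
    apply: eq_integral => t _; congr EFin; rewrite K_prod /W2 [RHS]mulrCA.
    apply: (congr1 (fun u => c * u)).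
    have [K0|K0] := eqVneq (K [::] t) 0; first by rewrite K0 !mulr0.
    by rewrite X2E.
  rewrite -lamE.
  - have := @iterated_integral_dirichlet R n (bw w) 1 c (bw0 w) (ltW c_gt0).
    rewrite (_ : ppow _ 1 = 1) ?mulr1; last by rewrite ppow_gt0// powR1.
    move=> <-; congr iterated_integral; apply/funext => t; congr (_ * _)%:E.
    by apply: eq_bigr => i _; rewrite (tnth_nth 0).
  - by apply/measurable_EFinP; exact: measurable_funM.
  - by move=> t; rewrite lee_fin mulr_ge0// ltW.
  - by move=> t i /(K_zero w) ->; rewrite mulr0.
(* Dividing by the product of the entries undoes the weight; the absolute value keeps the test
   function nonnegative on all tuples. *)
pose g B (z : n.+1.-tuple R) := \1_B z * `|\prod_i tnth z i|^-1.
(* The factor [k] stays inside, so no constant is pulled out of an iterated integral: [k = c^-1]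
   with the whole space computes [dirichlet_norm], and [k = 1] gives the law. *)
have gE k B' : 0 <= k -> measurable B' -> (k%:E * P [set x | B' (Xt x)])%E =
    iterated_integral (fun t => (k * (\1_B' (y t) * dirichlet_kernel alpha t * c))%:E).
  move=> k0 mB'; transitivity (k%:E * \int[P]_x (g B' (Xt x) * W1 x)%:E)%E.
    congr (_ * _)%E; transitivity (\int[P]_x (\1_(Xt @^-1` B') x)%:E)%E.
      by rewrite integral_indic ?setIT// -[X in measurable X]setTI; exact: mXt.
    apply: eq_integral => x _; rewrite /g (_ : \prod_i tnth (Xt x) i = W1 x).
      by rewrite ger0_norm ?(ltW (W1_gt0 x))// divfK ?gt_eqF.
    by apply: eq_bigr => i _; rewrite tnth_mktuple.
  have mg : measurable_fun setT (g B').
    apply: measurable_funM; first exact: measurable_indic.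
    under eq_fun do rewrite -powR_inv1//.
    apply: (measurableT_comp (measurable_powR _)); apply: measurableT_comp => //.
    by apply: measurable_prod => i _; exact: measurable_tnth.
  have g0 z : 0 <= g B' z by rewrite mulr_ge0 ?invr_ge0//; have /andP[] := indic01 R B' z.
  have e t : g B' (X2 t) * W2 t = \1_B' (y t) * dirichlet_kernel alpha t * c.
    rewrite /W2 /dirichlet_kernel -/(y t); case: ifPn => [/forallP ys|].
      have KE : K [::] t = \prod_i tnth (y t) i `^ (alpha i - 1) * \prod_i tnth (y t) i.
        rewrite -big_split/=; apply: eq_bigr => i _.
        rewrite /bw /b inord_val addr0 ppow_gt0// mulrC mulr_powRB1//.
        exact: ltW.
      have pr0 : 0 < \prod_i tnth (y t) i by apply: prodr_gt0 => i _.
      have K0 : K [::] t != 0.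
        by rewrite KE gt_eqF// mulr_gt0// prodr_gt0// => i _; exact: powR_gt0.
      rewrite X2E// /g ger0_norm ?ltW// KE.
      have := gt_eqF pr0; set p := \prod_i tnth _ _; set q := \prod_i _ => p0.
      transitivity (\1_B' (y t) * q * c * (p^-1 * p)); first by ring.
      by rewrite mulVf ?p0// mulr1.
    move=> nys; rewrite (_ : K [::] t = 0) ?mulr0 ?mul0r//.
    apply/eqP; apply: contraNT nys => /K_supp ys.
    by apply/forallP => i; have /andP[] := ys i.
  rewrite (@eq_integral_weighted _ _ _ _ _ _ _ P lam Xt X2 W1 W2)//.
  - have mgW : measurable_fun setT (fun t => g B' (X2 t) * W2 t).
      by apply: measurable_funM => //; exact: (measurableT_comp mg mX2).
    rewrite lamE.
    + rewrite -ge0_integralZl//; last 2 first.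
      * exact/measurable_EFinP.
      * by move=> t _; rewrite lee_fin mulr_ge0.
      by apply: eq_integral => t _; rewrite -e EFinM.
    + apply/measurable_EFinP; apply: measurable_funM => //.
      by under eq_fun do rewrite -e.
    + by move=> t; rewrite -e lee_fin mulr_ge0// mulr_ge0.
    + by move=> t i /(K_zero [::]) k1; rewrite -e /W2 k1 !mulr0.
  - exact: (proj1 bW1).
  - by move=> x; exact: ltW.
have cV : c^-1 * c = 1 by rewrite mulVf// gt_eqF.
have norm : dirichlet_norm alpha = c^-1.
  rewrite /dirichlet_norm -[RHS]/(fine (c^-1)%:E) -[in RHS](mule1 (c^-1)%:E).
  rewrite -(probability_setT P); congr fine.
  have := gE c^-1 setT; rewrite (_ : [set x | _] = setT); last by apply/seteqP; split.
  move=> -> //; last by rewrite invr_ge0 ltW.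
  congr iterated_integral; apply/funext => t.
  by rewrite indicT mul1r mulrCA cV mulr1.
have := gE 1 B ler01 mB; rewrite mul1e => ->; rewrite /dirichlet_law norm.
congr iterated_integral; apply/funext => t.
by rewrite invrK mul1r.
Qed.

End DirichletLaw.

(** * Paths in event trees *)

Section TreePaths.
Variable T : event_tree.
Implicit Types (s t : seq T) (u v : T).

Lemma edge_parent_unique u u' v : edge u v -> edge u' v -> u = u'.
Proof.
move=> uv u'v; have vr : v != Defs.root.
  by apply: contraTneq uv => ->; exact: root_orphan.
have /eqP/cards1P[x xE] := one_parent vr.
have : u \in [set x | edge x v]%SET by rewrite finset.inE.
have : u' \in [set x | edge x v]%SET by rewrite finset.inE.
by rewrite xE !finset.inE => /eqP -> /eqP.
Qed.

(** Read from the end: parents are unique and the root has none, so neither path can run out before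
    the other. *)
Lemma root_path_inj s t : path edge Defs.root s -> path edge Defs.root t ->
  last Defs.root s = last Defs.root t -> s = t.
Proof.
elim/last_ind: s t => [|s x ih] t.
  case/lastP: t => [//|t y] _; rewrite rcons_path last_rcons /= => /andP[_ ty] e.
  by move: ty; rewrite -e (negbTE (root_orphan _)).
case/lastP: t => [|t y]; rewrite ?rcons_path !last_rcons /=.
  move=> /andP[_ sx] _ e.
  by move: sx; rewrite e (negbTE (root_orphan _)).
move=> /andP[ps sx] /andP[pt ty] e; rewrite {x}e in sx *.
by rewrite (ih t)//; exact: edge_parent_unique ty.
Qed.

Lemma last_take_nth s i : (i <= size s)%N ->
  last Defs.root (take i s) = nth Defs.root (Defs.root :: s) i.
Proof.
move=> si; rewrite (last_nth Defs.root) size_takel//.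
by case: i si => [//|i] si /=; rewrite nth_take.
Qed.

(** A repeated node would end two prefixes of different lengths, against [root_path_inj]. *)
Lemma root_path_uniq s : path edge Defs.root s -> uniq (Defs.root :: s).
Proof.
move=> ps; apply/(uniqP Defs.root) => i j; rewrite !inE !ltnS => si sj.
rewrite -!last_take_nth// => e.
have pt k : path edge Defs.root (take k s).
  by move: ps; rewrite -[X in path _ _ X](cat_take_drop k) cat_path => /andP[].
have := root_path_inj (pt i) (pt j) e => /(congr1 size).
by rewrite !size_takel.
Qed.

Lemma root_path_size s : path edge Defs.root s -> (size s < #|T|)%N.
Proof.
move=> ps; rewrite -[(size s).+1]/(size (Defs.root :: s)).
by rewrite -(card_uniqP (root_path_uniq ps)) max_card.
Qed.

(** Turns passing through a node into having an initial segment, over which path sums can be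
    computed recursively. *)
Lemma mem_root_path s t : path edge Defs.root s -> path edge Defs.root t ->
  (last Defs.root t \in Defs.root :: s) = prefix t s.
Proof.
move=> ps pt; apply/idP/idP.
  move=> /splitPl; move: ps => /[swap] -[s1 s2 e]; rewrite cat_path => /andP[ps1 _].
  by rewrite (root_path_inj pt ps1)// prefix_prefix.
by move=> /prefixP[s' ->]; rewrite -cat_cons mem_cat mem_last.
Qed.

Lemma atomic_event_path (s : atomic_event T) : path edge Defs.root (val (val s)).
Proof. by have /andP[] := valP s. Qed.

Lemma prefix_rcons_nth s t v : prefix (rcons t v) s =
  [&& prefix t s, (size t < size s)%N & nth Defs.root s (size t) == v].
Proof.
apply/idP/and3P => [/prefixP[s' ->]|[/prefixP[s' ->]]].
  rewrite cat_rcons prefix_prefix size_cat /= nth_cat ltnn subnn /=.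
  by split=> //; rewrite addnS ltnS leq_addr.
rewrite size_cat nth_cat ltnn subnn; case: s' => [|x s'] /=.
  by rewrite addn0 ltnn.
by move=> _ /eqP ->; rewrite -cat_rcons prefix_prefix.
Qed.

Section Mass.
Variables (R : realType) (Omega : Type) (p : T -> T -> Omega -> R) (w : Omega).
Hypotheses (p_sum : forall u, ~~ leaf u -> \sum_(v | edge u v) p u v w = 1)
  (p_gt0 : forall u v, edge u v -> 0 < p u v w).

Let weight u t : R := \prod_(e <- zip (u :: t) t) p e.1 e.2 w.

Let weight_rcons u t v : weight u (rcons t v) = weight u t * p (last u t) v w.
Proof.
elim: t u => [|x t ih] u; rewrite /weight /= !big_cons.
  by rewrite !big_nil mulr1 mul1r.
by rewrite -mulrA; congr (_ * _); exact: ih.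
Qed.

(** Induction from the leaves upwards: at an inner end node the events split by their next node, and
    the edge probabilities there sum to 1. *)
Lemma sum_prefix_path_prob t : path edge Defs.root t ->
  \sum_(s : atomic_event T | prefix t (val (val s))) path_prob p s w = weight Defs.root t.
Proof.
have [n] := ubnP (#|T| - size t); elim: n t => [//|n ih] t; rewrite ltnS => tn pt.
have st := root_path_size pt.
have [lt|lt] := boolP (leaf (last Defs.root t)).
  have tT : (size t <= #|T|)%N by exact: ltnW.
  have h : path edge Defs.root (Bseq tT) && leaf (last Defs.root (Bseq tT)) by rewrite pt.
  rewrite (big_pred1 (exist _ (Bseq tT) h)) // => s.
  apply/idP/eqP => [|->]; last exact: prefix_refl.
  move=> /prefixP[s' e]; apply/val_inj/val_inj => /=; rewrite e.
  case: s' e => [|x s'] e; first by rewrite cats0.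
  have := atomic_event_path s; rewrite e cat_path /= => /and3P[_ tx _].
  by move/forallP : lt => /(_ x); rewrite tx.
have long (s : atomic_event T) : prefix t (val (val s)) -> (size t < size (val (val s)))%N.
  move=> /prefixP[s' e]; rewrite e size_cat; case: s' e => [|x s'] e; last first.
    by rewrite /= addnS ltnS leq_addr.
  have /andP[_] := valP s; rewrite e cats0 => l.
  by rewrite l in lt.
rewrite (partition_big (fun s : atomic_event T => nth Defs.root (val (val s)) (size t))
  (edge (last Defs.root t))); last first.
  move=> s ps; have := long s ps; move: ps => /prefixP[s' e]; have := atomic_event_path s.
  rewrite e cat_path size_cat nth_cat ltnn subnn.
  by case: s' e => [|x s'] e /=; [rewrite addn0 ltnn|move=> /and3P[]].
rewrite -[RHS]mulr1 -(p_sum lt) mulr_sumr; apply: eq_bigr => v lv.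
rewrite -weight_rcons -ih; last 2 first.
- by rewrite size_rcons subnS -ltnS prednK// subn_gt0.
- by rewrite rcons_path pt.
apply: eq_bigl => s; rewrite prefix_rcons_nth.
by have [ps|] := boolP (prefix t _) => //=; rewrite long.
Qed.

Lemma sum_path_prob : \sum_(s : atomic_event T) path_prob p s w = 1.
Proof.
have := @sum_prefix_path_prob [::] isT; rewrite /weight big_nil => <-.
by apply: eq_bigl => s; rewrite prefix0s.
Qed.

Let node_path v : exists2 t, path edge Defs.root t & v = last Defs.root t.
Proof. exact/connectP/Defs.root_connect. Qed.

Let mass v := \sum_(s : atomic_event T | v \in path_nodes s) path_prob p s w.

Let massE t : path edge Defs.root t -> mass (last Defs.root t) = weight Defs.root t.
Proof.
move=> pt; rewrite -sum_prefix_path_prob//; apply: eq_bigl => s.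
by rewrite /path_nodes mem_root_path//; exact: atomic_event_path.
Qed.

Let weight_gt0 t : path edge Defs.root t -> 0 < weight Defs.root t.
Proof.
elim/last_ind: t => [|t v ih]; first by rewrite /weight big_nil.
by rewrite rcons_path => /andP[pt tv]; rewrite weight_rcons mulr_gt0 ?ih ?p_gt0.
Qed.

Lemma path_prob_gt0 (s : atomic_event T) : 0 < path_prob p s w.
Proof. exact: (weight_gt0 (atomic_event_path s)). Qed.

Lemma sum_through_gt0 v :
  0 < \sum_(s : atomic_event T | v \in path_nodes s) path_prob p s w.
Proof.
by have [t pt ->] := node_path v; rewrite -/(mass _) massE// weight_gt0.
Qed.

(** Both sums are weights of root paths, the second path being one edge longer. This recovers the
    original edge probabilities from the path probabilities. *)
Lemma edge_prob_ratio u v : edge u v ->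
  p u v w * \sum_(s : atomic_event T | u \in path_nodes s) path_prob p s w
  = \sum_(s : atomic_event T | v \in path_nodes s) path_prob p s w.
Proof.
move=> uv; have [t pt ut] := node_path u; rewrite -/(mass u) -/(mass v).
have prt : path edge Defs.root (rcons t v) by rewrite rcons_path pt -ut.
have -> : v = last Defs.root (rcons t v) by rewrite last_rcons.
by rewrite massE// last_rcons weight_rcons -ut ut massE// -ut mulrC.
Qed.

End Mass.

Lemma through_child_exclusive u v v' (s : atomic_event T) : edge u v -> edge u v' ->
  v \in path_nodes s -> v' \in path_nodes s -> v = v'.
Proof.
move=> uv uv'; have [t pt ut] : exists2 t, path edge Defs.root t & u = last Defs.root t.
  exact/connectP/Defs.root_connect.
have h x : edge u x -> x \in path_nodes s -> nth Defs.root (val (val s)) (size t) = x.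
  move=> ux; have prt : path edge Defs.root (rcons t x) by rewrite rcons_path pt -ut.
  have := mem_root_path (atomic_event_path s) prt.
  by rewrite last_rcons /path_nodes => ->; rewrite prefix_rcons_nth => /and3P[_ _ /eqP].
by move=> vs v's; rewrite -(h v uv vs) (h v' uv' v's).
Qed.

Lemma through_parent u v (s : atomic_event T) : edge u v ->
  v \in path_nodes s -> u \in path_nodes s.
Proof.
move=> uv; have [t pt ut] : exists2 t, path edge Defs.root t & u = last Defs.root t.
  exact/connectP/Defs.root_connect.
have prt : path edge Defs.root (rcons t v) by rewrite rcons_path pt -ut.
have := mem_root_path (atomic_event_path s) prt; rewrite last_rcons /path_nodes => ->.
rewrite prefix_rcons_nth => /and3P[ps _ _].
by rewrite ut mem_root_path//; exact: atomic_event_path.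
Qed.

End TreePaths.

(** * Trees with one inner situation *)

Section HubTree.
Variables (J : finType) (A : {set J}).

(* [None] is the root, [Some None] the hub, and [Some (Some j)] the leaf of the
   atomic event [j]. *)
Definition hub_edge (u v : option (option J)) : bool :=
  match u, v with
  | None, Some None => true
  | None, Some (Some j) => j \notin A
  | Some None, Some (Some j) => j \in A
  | _, _ => false
  end.

Let hub_orphan u : ~~ hub_edge u None. Proof. by case: u => [[]|]. Qed.

Let hub_one_parent v : v != None -> #|[set u | hub_edge u v]%SET| = 1%N.
Proof.
case: v => [[j|]|] // _; apply/eqP/cards1P.
  exists (if j \in A then Some None else None); apply/setP => u.
  by rewrite !finset.inE; case: u => [[i|]|] /=; case: (j \in A).
by exists None; apply/setP => u; rewrite !finset.inE; case: u => [[i|]|].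
Qed.

Let hub_connect v : connect hub_edge None v.
Proof.
case: v => [[j|]|]; [|exact: connect1|exact: connect0].
have [jA|jA] := boolP (j \in A); last exact: connect1.
by apply: (@connect_trans _ _ (Some None)); exact: connect1.
Qed.

Definition hub_tree : event_tree :=
  @EventTree (option (option J)) hub_edge None hub_orphan hub_one_parent hub_connect.

Definition hub_path (j : J) : seq hub_tree :=
  if j \in A then [:: Some None; Some (Some j)] else [:: Some (Some j)].

Let hub_path_size j : (size (hub_path j) <= #|hub_tree|)%N.
Proof.
by rewrite !card_option /hub_path; case: ifP.
Qed.

Let hub_path_atomic j : path edge Defs.root (Bseq (hub_path_size j))
  && leaf (last Defs.root (Bseq (hub_path_size j))).
Proof.
rewrite /= /hub_path; case: (boolP (j \in A)) => jA /=; rewrite /= ?jA /=.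
  by apply/forallP => -[[]|].
by apply/forallP => -[[]|].
Qed.

Definition hub_event (j : J) : atomic_event hub_tree :=
  exist (fun s : {bseq #|hub_tree| of hub_tree} =>
    path edge Defs.root s && leaf (last Defs.root s)) _ (hub_path_atomic j).

Lemma mem_hub_path j (v : hub_tree) : (v \in path_nodes (hub_event j)) =
  match v with None => true | Some None => j \in A | Some (Some i) => i == j end.
Proof.
rewrite /path_nodes /= !inE; case: v => [[i|]|]; rewrite /hub_path //=.
  by case: ifP => _; rewrite !inE.
by case: ifP => _; rewrite !inE.
Qed.

(** With [A] empty the hub would be a leaf and add an atomic event. The element [j0] is also the
    default value of the inverse. *)
Lemma hub_event_bij (j0 : J) : j0 \in A -> bijective hub_event.
Proof.
move=> j0A; exists (fun s => if last None (val (val s)) is Some (Some j) then j else j0).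
  by move=> j /=; rewrite /hub_path; case: ifP.
move=> s; apply/val_inj/val_inj => /=.
case: s => -[s ss] /= /andP[].
case: s {ss} => [|[[j|]|] s] //=.
- by move=> _ /forallP /(_ (Some None)).
- case: s => [|[[i|]|] s] //=; rewrite ?andbF//.
  by move=> /andP[jA _] _; rewrite /hub_path (negbTE jA).
- case: s => [|[[j|]|] s] //=.
  + by move=> _ /forallP /(_ (Some (Some j0))); rewrite /edge /= j0A.
  + case: s => [|[[i|]|] s] //=; rewrite ?andbF//.
    by move=> /andP[jA _] _; rewrite /hub_path jA.
Qed.

Lemma hub_branching : (1 < #|A|)%N -> (Some None : hub_tree) \in branching hub_tree.
Proof.
have inj : injective (fun j : J => Some (Some j)) by move=> i j [].
move=> A1; rewrite finset.inE (leq_trans A1)// -(card_imset _ inj).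
apply/subset_leq_card/fintype.subsetP => _ /imsetP[j jA ->].
by rewrite finset.inE.
Qed.

Lemma root_branching : A != [set: J]%SET -> (None : hub_tree) \in branching hub_tree.
Proof.
move=> AT; have [j jA] : exists j, j \notin A.
  apply/existsP; apply: contraNT AT => /existsPn h; apply/eqP/setP => j.
  by rewrite finset.in_setT; exact: negbNE.
rewrite finset.inE.
have <- : #|[set (Some None : hub_tree); Some (Some j)]%SET| = 2%N by rewrite cards2.
apply/subset_leq_card/fintype.subsetP => v; rewrite !finset.inE.
by move=> /orP[] /eqP ->.
Qed.

End HubTree.

(** * Independent florets and factorization of expectations *)

Section Independence.
Context {d : measure_display} {Omega : measurableType d} {R : realType}
  (P : probability Omega R).

Lemma sigma_ofT (J : Type) (X : J -> Omega -> R) : sigma_of X setT.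
Proof. by rewrite -setC0; apply: sigma_algebraC; exact: sigma_algebra0. Qed.

(** Stages are singletons, so their representatives are forced; giving every other floret the sure
    event reduces mutual independence to the pair. *)
Lemma finest_florets_independent (T : event_tree) (p : T -> T -> Omega -> R)
    (u v : T) (A B : set Omega) :
  independent_florets P (C := finest_ceg T) p ->
  u \in branching T -> v \in branching T -> u != v ->
  sigma_of (floret_vector p (v := u)) A -> sigma_of (floret_vector p (v := v)) B ->
  P (A `&` B) = (P A * P B)%E.
Proof.
move=> ind uT vT uv sA sB.
have st x : x \in branching T -> [set x]%SET \in stages (finest_ceg T).
  by move=> xT; exact: imset_f.
pose su : stage (finest_ceg T) :=
  exist (fun U : {set T} => U \in stages (finest_ceg T)) _ (st u uT).
pose sv : stage (finest_ceg T) :=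
  exist (fun U : {set T} => U \in stages (finest_ceg T)) _ (st v vT).
have stageP (U : stage (finest_ceg T)) : exists x, val U = [set x]%SET.
  by have /imsetP[x _ e] := valP U; exists x.
pose r (U : stage (finest_ceg T)) : T := odflt u [pick x in val U].
have rU U : r U \in val U.
  rewrite /r; case: pickP => [x //|]; have [x ->] := stageP U.
  by move=> /(_ x); rewrite finset.inE eqxx.
have ru : r su = u by have := rU su; rewrite finset.inE => /eqP.
have rv : r sv = v by have := rU sv; rewrite finset.inE => /eqP.
have suv : sv != su.
  apply: contra uv => /eqP /(congr1 val) /= /setP /(_ u).
  by rewrite !finset.inE eqxx.
pose D U := if U == su then A else if U == sv then B else setT.
have sD U : sigma_of (floret_vector p (v := r U)) (D U).
  rewrite /D; case: eqP => [->|_]; first by rewrite ru.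
  by case: eqP => [->|_]; [rewrite rv|exact: sigma_ofT].
have := ind r rU D sD [set su; sv]%SET.
rewrite big_setU1 ?finset.inE 1?eq_sym//= big_set1 /D eqxx (negbTE suv) eqxx => <-.
congr (P _); apply/seteqP; split=> x.
  move=> [Ax Bx] U /=; rewrite !finset.inE => /orP[] /eqP ->; first by rewrite eqxx.
  by rewrite (negbTE suv) eqxx.
move=> h; split.
  by have := h su; rewrite /= !finset.inE eqxx; apply.
have := h sv; rewrite /= !finset.inE eqxx orbT (negbTE suv); exact.
Qed.

(** [Omega] under the sigma-algebra generated by [X]: measurability on this type says that a
    variable depends on [X] only, without exhibiting it as a function of [X]. *)
Definition sigma_type (J : Type) (X : J -> Omega -> R) :=
  g_sigma_algebraType [set A | exists j, exists2 B : set R, measurable B & A = X j @^-1` B].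

Lemma measurable_sigma_type (J : Type) (X : J -> Omega -> R) j :
  measurable_fun (setT : set (sigma_type X)) (X j : sigma_type X -> R).
Proof.
move=> _ B mB; rewrite setTI; apply: sub_sigma_algebra.
by exists j; exists B.
Qed.

Lemma sigma_of_preimage (J : Type) (X : J -> Omega -> R) (V : sigma_type X -> R) B :
  measurable_fun setT V -> measurable B -> sigma_of X (V @^-1` B).
Proof. by move=> mV mB; rewrite -[_ @^-1` _]setTI; exact: mV. Qed.

Lemma sigma_of_sub (J J' : Type) (X : J -> Omega -> R) (X' : J' -> Omega -> R) :
  (forall j, exists j', X j = X' j') -> sigma_of X `<=` sigma_of X'.
Proof.
move=> XX'; apply: smallest_sub; first exact: smallest_sigma_algebra.
move=> _ [j [B mB ->]]; have [j' ->] := XX' j.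
by apply: sub_sigma_algebra; exists j'; exists B.
Qed.

Lemma integral_product_independent (U V : Omega -> R) :
  measurable_fun setT U -> measurable_fun setT V ->
  (forall x, 0 <= U x) -> (forall x, 0 <= V x) ->
  (forall A B, measurable A -> measurable B ->
    P (U @^-1` A `&` V @^-1` B) = P (U @^-1` A) * P (V @^-1` B))%E ->
  (\int[P]_x (U x)%:E < +oo)%E ->
  (\int[P]_x (U x * V x)%:E = (\int[P]_x (U x)%:E) * \int[P]_x (V x)%:E)%E.
Proof.
move=> mU mV U0 V0 ind fin.
have mi (f : Omega -> R) A : measurable_fun setT f -> measurable A -> measurable (f @^-1` A).
  by move=> mf mA; rewrite -[_ @^-1` _]setTI; exact: mf.
have mI (f : Omega -> R) A : measurable_fun setT f -> measurable A ->
    measurable_fun setT (fun x => \1_A (f x) : R).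
  by move=> mf mA; apply: (measurableT_comp _ mf); exact: measurable_indic.
have I0 (A : set R) x : 0 <= (\1_A x : R) by rewrite indicE.
have int1 (f : Omega -> R) A : measurable_fun setT f -> measurable A ->
    (\int[P]_x (\1_A (f x))%:E = P (f @^-1` A))%E.
  move=> mf mA; transitivity (\int[P]_x (\1_(f @^-1` A) x)%:E)%E; first by [].
  by rewrite integral_indic ?setIT//; exact: mi.
have pf (A : set Omega) : measurable A -> ((fine (P A))%:E = P A)%E.
  by move=> mA; rewrite fineK// fin_num_measure.
have nrm (f g : Omega -> R) : (forall x, 0 <= f x) ->
    (\int[P]_x (f x * g x)%:E = \int[P]_x (`|f x| * g x)%:E)%E.
  by move=> f0; apply: eq_integral => x _; rewrite ger0_norm.
(* Against the law of [U], the indicator of an event of [V] may be replaced by its probability; the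
   same exchange against the law of [V] then replaces [U] by its mean. *)
have step1 B : measurable B ->
    (\int[P]_x (U x * \1_B (V x))%:E = \int[P]_x (U x * fine (P (V @^-1` B)))%:E)%E.
  move=> mB; rewrite (nrm U)// [RHS](nrm U)//.
  apply: (@eq_integral_weighted _ _ _ _ _ _ _ P P U U
    (fun x => \1_B (V x)) (fun=> fine (P (V @^-1` B))) _ _ _ _ _ _ _ (fun x => `|x|)) => //.
  - exact: mI.
  - by move=> x; rewrite fine_ge0.
  move=> A mA; transitivity (P (U @^-1` A `&` V @^-1` B)).
    transitivity (\int[P]_x (\1_(U @^-1` A `&` V @^-1` B) x)%:E)%E.
      by apply: eq_integral => x _; rewrite indicI.
    by rewrite integral_indic ?setIT//; apply: measurableI; exact: mi.
  rewrite ind//; transitivity (\int[P]_x ((fine (P (V @^-1` B)))%:E * (\1_A (U x))%:E))%E.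
    rewrite ge0_integralZl//; last 2 first.
    - by apply/measurable_EFinP; exact: mI.
    - by rewrite lee_fin fine_ge0.
    by rewrite pf ?int1 1?muleC//; exact: mi.
  by apply: eq_integral => x _; rewrite -EFinM mulrC.
have Ufin : ((fine (\int[P]_x (U x)%:E))%:E = \int[P]_x (U x)%:E)%E.
  by rewrite fineK// ge0_fin_numE// integral_ge0// => x _; rewrite lee_fin.
have eU0 : 0 <= fine (\int[P]_x (U x)%:E)%E.
  by rewrite fine_ge0// integral_ge0// => x _; rewrite lee_fin.
transitivity (\int[P]_x (V x * U x)%:E)%E.
  by apply: eq_integral => x _; rewrite mulrC.
transitivity (\int[P]_x (V x * fine (\int[P]_x (U x)%:E)%E)%:E)%E.
  rewrite (nrm V)// [RHS](nrm V)//.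
  apply: (@eq_integral_weighted _ _ _ _ _ _ _ P P V V U
    (fun=> fine (\int[P]_x (U x)%:E)%E) _ _ _ _ _ _ _ (fun x => `|x|)) => //.
  move=> B mB; transitivity (\int[P]_x (U x * \1_B (V x))%:E)%E.
    by apply: eq_integral => x _; rewrite mulrC.
  rewrite step1//.
  transitivity (\int[P]_x ((fine (P (V @^-1` B)))%:E * (U x)%:E))%E.
    by apply: eq_integral => x _; rewrite -EFinM mulrC.
  rewrite ge0_integralZl//; last 3 first.
  - exact/measurable_EFinP.
  - by move=> x _; rewrite lee_fin.
  - by rewrite lee_fin fine_ge0.
  transitivity (\int[P]_x ((fine (\int[P]_x (U x)%:E)%E)%:E * (\1_B (V x))%:E))%E.
    rewrite ge0_integralZl//; last by apply/measurable_EFinP; exact: mI.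
    by rewrite Ufin int1// pf 1?muleC//; exact: mi.
  by apply: eq_integral => x _; rewrite -EFinM mulrC.
transitivity (\int[P]_x ((fine (\int[P]_x (U x)%:E)%E)%:E * (V x)%:E))%E.
  by apply: eq_integral => x _; rewrite -EFinM mulrC.
rewrite ge0_integralZl//; last 2 first.
- exact/measurable_EFinP.
- by move=> x _; rewrite lee_fin.
by rewrite Ufin.
Qed.

End Independence.

(** * Aggregation and florets *)

Lemma sum_count_mem (J : finType) (B : {set J}) (w : seq J) :
  (\sum_(j in B) count_mem j w)%N = count (mem B) w.
Proof.
elim: w => [|k w ih] /=; first by rewrite big1.
rewrite big_split/= ih; congr addn.
have [kB|kB] := boolP (k \in B).
  by rewrite (bigD1 k)//= eqxx big1 ?addn0// => j /andP[_ /negbTE]; rewrite eq_sym => ->.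
by rewrite big1// => j jB; case: eqP => // kj; rewrite kj jB in kB.
Qed.

Lemma Rintegral_probability_cst d (Omega : measurableType d) (R : realType)
  (P : probability Omega R) (c : R) : \int[P]_x c = c.
Proof.
rewrite Rintegral_cst// -[RHS]mulr1; congr (_ * _).
by rewrite [X in fine X](@probability_setT _ _ _ P).
Qed.

Section Aggregation.
Context {d : measure_display} {Omega : measurableType d} {R : realType}
  (P : probability Omega R).

Lemma has_dirichlet_law_of_moments (J : finType) (X : J -> Omega -> R)
    (alpha : J -> R) :
  (0 < #|J|)%N -> (forall j, measurable_fun setT (X j)) ->
  (forall j x, 0 < X j x) -> (forall x, \sum_j X j x = 1) ->
  (forall j, 0 < alpha j) -> dirichlet_moments P X alpha ->
  has_dirichlet_law P X.
Proof.
case n_def : #|J| => [//|n] _ mX X0 X1 alpha0 rec.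
pose e (i : 'I_n.+1) : J := enum_val (cast_ord (esym n_def) i).
have eb : bijective e.
  exists (fun j => cast_ord n_def (enum_rank j)) => [i|j].
    by rewrite /e enum_valK cast_ordKV.
  by rewrite /e cast_ordK enum_rankK.
exists n, e, alpha; split=> // B mB.
have sume (F : J -> R) : \sum_j F j = \sum_i F (e i).
  by rewrite (reindex e) //; exact: onW_bij.
apply: (@dirichlet_law_of_moments _ _ _ P n (X \o e) (alpha \o e)) => //.
- by move=> i; exact: mX.
- by move=> i x; exact: X0.
- by move=> x; rewrite -(X1 x) sume.
- by move=> i; exact: alpha0.
move=> i w; have me u : moment P (X \o e) u = moment P X (map e u).
  by rewrite /moment; apply: eq_Rintegral => x _; rewrite big_map.
have := rec (e i) (map e w); rewrite !me size_map sume => -> /=.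
rewrite count_map; congr ((_ + _%:R) * _); apply: eq_count => k /=.
by rewrite (inj_eq (bij_inj eb)).
Qed.

Variables (J : finType) (X : J -> Omega -> R) (alpha : J -> R).
Hypotheses (bX : forall j, bounded_measurable (X j))
  (rec : dirichlet_moments P X alpha).

Definition block_sum (B : {set J}) (x : Omega) : R := \sum_(j in B) X j x.

Lemma bounded_block_sum B : bounded_measurable (block_sum B).
Proof. exact: bounded_measurable_sum. Qed.

(** The blocks are disjoint but need not cover [J], so the total on the left remains that of all
    [alpha]. *)
Lemma block_sum_moments (I : finType) (B : I -> {set J}) :
  (forall i k j, j \in B i -> j \in B k -> i = k) ->
  forall i u, moment P (fun i => block_sum (B i)) (i :: u)
      * (\sum_j alpha j + (size u)%:R)
    = (\sum_(j in B i) alpha j + (count_mem i u)%:R)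
      * moment P (fun i => block_sum (B i)) u.
Proof.
move=> disj i u; pose Z i := block_sum (B i).
pose E u w := \int[P]_x (\prod_(k <- u) Z k x * \prod_(j <- w) X j x).
have bE u' w' : bounded_measurable
    (fun x => \prod_(k <- u') Z k x * \prod_(j <- w') X j x).
  apply: bounded_measurableM; apply: bounded_measurable_prod => // k.
  exact: bounded_block_sum.
have E_cons k u' w' : E (k :: u') w' = \sum_(j in B k) E u' (j :: w').
  rewrite /E -Rintegral_bounded_sum//; apply: eq_Rintegral => x _.
  rewrite big_cons {1}/Z /block_sum -mulrA mulr_suml; apply: eq_bigr => j _.
  by rewrite big_cons mulrCA.
(* Expanding the block sums one at a time turns them into single entries [w]. *)
suff main w : E (i :: u) w * (\sum_j alpha j + (size u + size w)%:R) =
    (\sum_(j in B i) alpha j + (count_mem i u + count (mem (B i)) w)%:R) * E u w.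
  have mE u' : moment P Z u' = E u' [::].
    by apply: eq_Rintegral => x _; rewrite big_nil mulr1.
  by have := main [::]; rewrite -!mE /= !addn0.
elim: u w => [|k u ih] w.
  have mE w' : E [::] w' = moment P X w'.
    by apply: eq_Rintegral => x _; rewrite big_nil mul1r.
  rewrite E_cons /= !add0n mulr_suml mE -sum_count_mem natr_sum -big_split/= mulr_suml.
  by apply: eq_bigr => j _; rewrite mE -rec.
(* With [k] in front its block sum expands into entries [j]; by disjointness such a [j] lies in
   [B i] exactly when [k = i], so the counts match. *)
have swap w' : E [:: i, k & u] w' = E [:: k, i & u] w'.
  by apply: eq_Rintegral => x _; rewrite !big_cons mulrCA.
rewrite swap !E_cons mulr_suml mulr_sumr; apply: eq_bigr => j jk.
have := ih (j :: w); rewrite /= addSnnS => ->; congr (_ * _).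
have -> : (j \in B i) = (k == i).
  by apply/idP/eqP => [ji|<-//]; exact: disj jk ji.
by rewrite addnCA addnA.
Qed.

End Aggregation.

(** * Path probabilities and florets under Markov equivalence *)

Section MarkovEquivalence.
Context {d : measure_display} {Omega : measurableType d} {R : realType}
  (P : probability Omega R) (T : event_tree) (p : T -> T -> Omega -> R).
Hypothesis hp : random_edge_probabilities p.
Hypothesis indep : forall (C' : ceg) (f : atomic_event T -> atomic_event C'),
  markov_equivalent (C := finest_ceg T) p f ->
  independent_florets P (induced_edge_prob (path_prob p) f).

Local Notation J := (atomic_event T).
Local Notation q := (path_prob p).

Lemma path_prob_pos j x : 0 < q j x.
Proof. by apply: path_prob_gt0 => u v; case: hp => _ + _; exact. Qed.

Lemma path_prob_sum x : \sum_j q j x = 1.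
Proof. by apply: sum_path_prob => u; case: hp => _ _; exact. Qed.

Lemma bounded_path_prob j : bounded_measurable (q j).
Proof.
apply: bounded_measurable01 => [|x]; last first.
  rewrite ltW ?path_prob_pos//= -(path_prob_sum x) (bigD1 j)//= lerDl.
  by apply: sumr_ge0 => i _; rewrite ltW ?path_prob_pos.
have : {in path_edges j, forall e, edge e.1 e.2}.
  have := atomic_event_path j; rewrite /path_edges /path_nodes.
  move: (Defs.root) (val (val j)) => u t.
  elim: t u => [//|v t ih] u /= /andP[uv vt] e; rewrite inE => /orP[/eqP -> //|].
  exact: ih.
rewrite /path_prob => edges; apply: measurable_prod => e /edges ee.
by case: hp => + _ _; exact.
Qed.

Local Notation qA := (block_sum q).

Lemma finest_markov_equivalent (T' : event_tree) (f : J -> atomic_event T') :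
  bijective f -> markov_equivalent (C := finest_ceg T) (C' := finest_ceg T') p f.
Proof.
move=> fb; split=> // U /imsetP[x _ ->] u v; rewrite !finset.inE => /eqP -> /eqP ->.
by exists id => //; exists id.
Qed.

Lemma block_sum_gt0 (B : {set J}) x : (0 < #|B|)%N -> 0 < qA B x.
Proof.
move=> /card_gt0P[j jB]; rewrite /block_sum (bigD1 j)//= ltr_wpDr ?path_prob_pos//.
by apply: sumr_ge0 => i _; rewrite ltW ?path_prob_pos.
Qed.

Definition normalized (B : {set J}) (j : {j : J | j \in B}) (x : Omega) : R :=
  q (val j) x / qA B x.

Lemma hub_independence (B : {set J}) (S1 : set R) (S2 : set Omega) :
  (1 < #|B|)%N -> B != [set: J]%SET -> measurable S1 ->
  sigma_of (@normalized B) S2 ->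
  P (qA B @^-1` S1 `&` S2) = (P (qA B @^-1` S1) * P S2)%E.
Proof.
move=> B1 BT mS1 sS2.
have [j0 j0B] : exists j0, j0 \in B by apply/card_gt0P; exact: leq_trans B1.
have fb := hub_event_bij j0B.
have ind := indep (finest_markov_equivalent fb).
pose ip := induced_edge_prob q (hub_event B).
have ip_root x : ip None (Some None) x = qA B x.
  rewrite /ip /induced_edge_prob (eq_bigl (mem B)) => [|j]; last first.
    by rewrite mem_hub_path.
  rewrite [X in _ / X](eq_bigl xpredT) => [|j]; last by rewrite mem_hub_path.
  by rewrite path_prob_sum divr1.
have ip_hub j x : ip (Some None) (Some (Some j)) x = q j x / qA B x.
  rewrite /ip /induced_edge_prob (eq_bigl (pred1 j)) => [|i]; last first.
    by rewrite mem_hub_path /= eq_sym.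
  rewrite big_pred1_eq; congr (_ / _); apply: eq_bigl => i.
  by rewrite mem_hub_path.
apply: (finest_florets_independent ind (root_branching BT) (hub_branching B1)) => //.
  pose e : @floret_edge (hub_tree B) None :=
    exist (fun w : hub_tree B => edge (None : hub_tree B) w) (Some None) isT.
  apply: sub_sigma_algebra; exists e, S1 => //.
  rewrite (_ : qA B = floret_vector ip e)//.
  by apply/funext => x; rewrite -ip_root.
apply: sigma_of_sub sS2 => -[j jB].
exists (exist (fun w : hub_tree B => edge (Some None : hub_tree B) w) (Some (Some j)) jB).
by apply/funext => x; rewrite /normalized /floret_vector /= -/(ip _ _ _) ip_hub.
Qed.

Lemma hub_expectation (B : {set J}) (h : R -> R) (V : sigma_type (@normalized B) -> R) :
  (1 < #|B|)%N -> B != [set: J]%SET ->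
  measurable_fun setT h -> (forall x, 0 <= h x) ->
  bounded_measurable (fun x => h (qA B x)) ->
  measurable_fun setT V -> bounded_measurable (V : Omega -> R) -> (forall x, 0 <= V x) ->
  \int[P]_x (h (qA B x) * V x)
  = (\int[P]_x h (qA B x)) * \int[P]_x (V : Omega -> R) x.
Proof.
move=> B1 BT mh h0 bh mV bV V0.
have := @integral_product_independent _ _ _ P (fun x => h (qA B x)) V.
rewrite -!EFin_Rintegral//; last exact: bounded_measurableM.
rewrite -EFinM => H; apply: EFin_inj; apply: H => //.
- exact: (proj1 bh).
- exact: (proj1 bV).
- move=> S1 S2 mS1 mS2.
  apply: (@hub_independence B (h @^-1` S1) (V @^-1` S2) B1 BT); last first.
    exact: sigma_of_preimage.
  by rewrite -[X in measurable X]setTI; exact: mh.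
- exact: ltry.
Qed.

Hypothesis card_J : (2 < #|J|)%N.

Let outside (i : J) (w : seq J) := [seq j <- w | j != i].

Let block_sumC i x : qA [set~ i]%SET x = 1 - q i x.
Proof.
rewrite -(path_prob_sum x) [in RHS](bigD1 i)//= [RHS]addrC addKr.
by apply: eq_bigl => j; rewrite !finset.inE.
Qed.

Let card_setC1 (i : J) : (1 < #|[set~ i]%SET|)%N.
Proof. by rewrite finset.cardsC1 -ltnS prednK// (leq_trans _ card_J). Qed.

Let setC1_neqT (i : J) : [set~ i]%SET != [set: J]%SET.
Proof. by apply/eqP => /setP /(_ i); rewrite !finset.inE eqxx. Qed.

Let shape i a K := \int[P]_x (q i x ^+ a * (1 - q i x) ^+ K).

Let ratio_product i w (x : Omega) := \prod_(j <- outside i w) (q j x / qA [set~ i]%SET x).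

Let q_lt1 (i : J) x : q i x < 1.
Proof.
rewrite -subr_gt0 -block_sumC; apply: block_sum_gt0.
by apply: leq_trans (card_setC1 i).
Qed.

Let bounded_shape i a K : bounded_measurable (fun x => q i x ^+ a * (1 - q i x) ^+ K).
Proof.
have q01 x : 0 <= q i x /\ q i x <= 1 by rewrite !ltW ?path_prob_pos.
have mq := proj1 (bounded_path_prob i).
apply: bounded_measurable01 => [|x].
  apply: measurable_funM; apply: measurable_funX => //.
  exact: measurable_funB.
have [q0 q1] := q01 x; have s0 : 0 <= 1 - q i x by rewrite subr_ge0.
rewrite mulr_ge0 ?exprn_ge0//= mulr_ile1 ?exprn_ge0// exprn_ile1//.
by rewrite gerBl.
Qed.

Let shape_gt0 i a K : 0 < shape i a K.
Proof.
apply: Rintegral_gt0 => // x.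
by rewrite mulr_gt0// exprn_gt0 ?path_prob_pos// subr_gt0.
Qed.

(** Writing [q j] as [(1 - q i) * (q j / (1 - q i))] for [j != i] separates a function of [q i] from
    one of the normalized complement, and neutrality factors the expectation. The second factor
    ignores the letters [i], so prefixing an [i] changes only [shape]. *)
Let moment_shape i w : moment P q w =
  shape i (count_mem i w) (size w - count_mem i w) * \int[P]_x ratio_product i w x.
Proof.
set B := [set~ i]%SET.
have szo : size (outside i w) = (size w - count_mem i w)%N.
  rewrite size_filter -(count_predC (pred1 i) w) addKn.
  by apply: eq_count => j.
have out j : j \in outside i w -> j \in B.
  by rewrite mem_filter !finset.inE => /andP[].
have qB0 x : 0 < qA B x by apply: block_sum_gt0; exact: leq_trans (card_setC1 i).
have mV : measurable_fun (setT : set (sigma_type (@normalized B))) (ratio_product i w).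
  apply: measurable_prod => j /out jB.
  exact: (measurable_sigma_type (X := @normalized B) (exist _ j jB)).
have V01 x : 0 <= ratio_product i w x <= 1.
  rewrite /ratio_product; elim: (outside i w) out => [|j l ih] out.
    by rewrite big_nil ler01 lexx.
  have /andP[h0 h1] : 0 <= q j x / qA B x <= 1.
    rewrite divr_ge0 ?(ltW (qB0 x)) ?(ltW (path_prob_pos j x))//= ler_pdivrMr// mul1r.
    rewrite /block_sum (bigD1 j)/=; last by apply: out; rewrite inE eqxx.
    by rewrite lerDl sumr_ge0// => k _; rewrite ltW ?path_prob_pos.
  have /andP[g0 g1] := ih (fun k kl => out k (mem_behead (s := j :: l) kl)).
  by rewrite big_cons mulr_ge0//= mulr_ile1.
have mVO : measurable_fun setT (ratio_product i w : Omega -> R).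
  apply: measurable_prod => j _; apply: measurable_funM.
    exact: (proj1 (bounded_path_prob j)).
  under eq_fun => x do rewrite -(powR_inv1 (ltW (qB0 x))).
  apply: (measurableT_comp (measurable_powR _)).
  exact: (proj1 (bounded_block_sum bounded_path_prob _)).
pose h (u : R) := `|(1 - u) ^+ count_mem i w * u ^+ size (outside i w)|.
have hE x : h (qA B x) = q i x ^+ count_mem i w * (1 - q i x) ^+ (size w - count_mem i w).
  rewrite /h szo block_sumC opprB addrC subrK ger0_norm//.
  by rewrite mulr_ge0 ?exprn_ge0 ?subr_ge0 ?ltW ?path_prob_pos.
have mh : measurable_fun setT h.
  apply: measurableT_comp => //; apply: measurable_funM; apply: measurable_funX => //.
  exact: measurable_funB.
have bh : bounded_measurable (fun x => h (qA B x)).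
  rewrite (_ : (fun x => h (qA B x)) =
    (fun x => q i x ^+ count_mem i w * (1 - q i x) ^+ (size w - count_mem i w))).
    exact: bounded_shape.
  by apply/funext => x; exact: hE.
have h0 u : 0 <= h u by exact: normr_ge0.
have V0 x : 0 <= ratio_product i w x by have /andP[] := V01 x.
have bV : bounded_measurable (ratio_product i w : Omega -> R) by exact: bounded_measurable01.
have := @hub_expectation B h (ratio_product i w) (card_setC1 i) (setC1_neqT i) mh h0 bh mV bV V0.
rewrite /shape; under [in X in _ -> _ = X * _]eq_Rintegral do rewrite -hE.
move=> <-; apply: eq_Rintegral => x _; rewrite hE -szo /ratio_product.
rewrite prodf_div [X in _ / X](eq_bigr (fun=> qA B x)) => [|//].
rewrite big_const_seq count_predT iter_mulr_1 block_sumC.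
have s0 : (1 - q i x) ^+ size (outside i w) != 0.
  by rewrite expf_neq0// gt_eqF// subr_gt0.
have cancel (a b c : R) : b != 0 -> a * b * (c / b) = a * c by move=> b0; field.
rewrite cancel//.
rewrite (bigID (pred1 i))/= /outside big_filter; congr (_ * _).
rewrite (eq_bigr (fun=> q i x)) => [|j /eqP -> //].
by rewrite big_const_seq iter_mulr_1.
Qed.

Lemma path_prob_dirichlet_moments :
  ~ almost_surely_constant P q ->
  exists2 alpha : J -> R, (forall j, 0 < alpha j) & dirichlet_moments P q alpha.
Proof.
move=> nconst.
have bq w : bounded_measurable (fun x => \prod_(j <- w) q j x).
  by apply: bounded_measurable_prod => j; exact: bounded_path_prob.
have M_nil : moment P q [::] = 1.
  rewrite /moment; under eq_Rintegral do rewrite big_nil.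
  by rewrite Rintegral_probability_cst.
have [|||||[alpha [alpha0 rec]]|sq] := @moment_recursion_dichotomy R J (moment P q)
    (fun i a N => shape i a.+1 (N - a) / shape i a (N - a)) card_J.
- move=> w; apply: Rintegral_gt0 => // x; apply: prodr_gt0 => j _.
  exact: path_prob_pos.
- exact: M_nil.
- by move=> w w' ww'; apply: eq_Rintegral => x _; exact: perm_big.
- move=> w; rewrite /moment -Rintegral_bounded_sum//; apply: eq_Rintegral => x _.
  transitivity (\sum_i q i x * \prod_(j <- w) q j x).
    by apply: eq_bigr => i _; rewrite big_cons.
  by rewrite -mulr_suml path_prob_sum mul1r.
- move=> i w; rewrite !(moment_shape i) /= eqxx add1n subSS mulrA divfK ?gt_eqF//.
  by congr (_ * _); apply: eq_Rintegral => x _; rewrite /ratio_product /outside /= eqxx.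
- by exists alpha.
(* In the degenerate case every variance vanishes, and each entry equals its mean almost surely. *)
exfalso; apply: nconst; exists (fun j => moment P q [:: j]).
pose m j := moment P q [:: j]; pose D j (x : Omega) := (q j x - m j) ^+ 2.
have bD j : bounded_measurable (D j).
  have b1 : bounded_measurable (fun x => q j x + - m j).
    have [mq [C qC]] := bounded_path_prob j; split; first exact: measurable_funD.
    by exists (C + `|m j|) => x; rewrite (le_trans (ler_normD _ _))// normrN lerD.
  exact: (bounded_measurableM b1 b1).
have D0 j : \int[P]_x D j x = 0.
  have e x : D j x + (2 * m j) * \prod_(i <- [:: j]) q i x
      = \prod_(i <- [:: j; j]) q i x + m j ^+ 2.
    by rewrite /D !big_cons !big_nil; ring.
  have b2 c : bounded_measurable (fun x => c * \prod_(i <- [:: j]) q i x).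
    by apply: bounded_measurableM => //; exact: bounded_measurable_cst.
  have : \int[P]_x (D j x + (2 * m j) * \prod_(i <- [:: j]) q i x)
      = \int[P]_x (\prod_(i <- [:: j; j]) q i x + m j ^+ 2).
    by apply: eq_Rintegral => x _; exact: e.
  have i1 := bounded_measurable_integrable P (bD j).
  have i2 := bounded_measurable_integrable P (b2 (2 * m j)).
  have i3 := bounded_measurable_integrable P (bq [:: j; j]).
  have i4 := bounded_measurable_integrable P (bounded_measurable_cst (m j ^+ 2)).
  have i5 := bounded_measurable_integrable P (bq [:: j]).
  rewrite (RintegralD measurableT i1 i2) (RintegralD measurableT i3 i4).
  rewrite (RintegralZl _ measurableT i5) Rintegral_probability_cst.
  rewrite -/(moment P q [:: j; j]) sq -/(moment P q [:: j]) -/(m j) => h; lra.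
(* The sum of the squared deviations yields one null set for all coordinates at once. *)
pose S x := \sum_j D j x.
have bS : bounded_measurable S by exact: bounded_measurable_sum.
have S0 x : 0 <= S x by apply: sumr_ge0 => k _; exact: sqr_ge0.
have intS : (\int[P]_x `|(S x)%:E| = 0)%E.
  rewrite (eq_integral (EFin \o S)) => [|x _]; last by rewrite /= ger0_norm.
  rewrite -(EFin_Rintegral P bS) Rintegral_bounded_sum//.
  by rewrite big1// => j _; exact: D0.
have mS : measurable_fun setT (EFin \o S) by apply/measurable_EFinP; exact: (proj1 bS).
have [ae _] := ae_eq_integral_abs P measurableT mS.
have [N [mN N0 sub]] := ae intS.
exists N; split=> // x /= nx; apply: sub => /= /(_ I) [Sx].
apply: nx => j; apply/eqP; rewrite -subr_eq0 -sqrf_eq0.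
have /allP/(_ j) : all (fun j => true ==> (D j x == 0)) (index_enum J).
  by rewrite -psumr_eq0; [apply/eqP; exact: Sx|move=> k _; exact: sqr_ge0].
by rewrite mem_index_enum => /(_ isT).
Qed.

Section Floret.
Variables (alpha : J -> R) (v : T).
Hypotheses (alpha0 : forall j, 0 < alpha j) (rec : dirichlet_moments P q alpha)
  (v_branching : v \in branching T).

Let through (u : T) : {set J} := [set s | u \in path_nodes s]%SET.
Let B (e : floret_edge v) : {set J} := through (val e).
Let Y (e : floret_edge v) (x : Omega) : R := floret_vector p e x.

Let qAE u x : qA (through u) x = \sum_(s | u \in path_nodes s) q s x.
Proof. by apply: eq_bigl => s; rewrite finset.inE. Qed.

Let p1 x u : ~~ leaf u -> \sum_(w | edge u w) p u w x = 1.
Proof. by case: hp => _ _; exact. Qed.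

Let p0 x u w : edge u w -> 0 < p u w x.
Proof. by case: hp => _ + _; exact. Qed.

Let qA_gt0 u x : 0 < qA (through u) x.
Proof. by rewrite qAE; apply: sum_through_gt0 => [w|w w']; [exact: p1|exact: p0]. Qed.

(** The mass through [u] is positive at any sample point, and a probability space has one. *)
Let card_through u : (0 < #|through u|)%N.
Proof.
rewrite lt0n; apply/negP => /eqP /cards0_eq t0.
have : P setT = 0%E.
  rewrite (_ : setT = set0) ?measure0//; apply/seteqP; split=> // x _.
  by have := qA_gt0 u x; rewrite t0 /block_sum big_set0 ltxx.
by rewrite probability_setT => /eqP; rewrite onee_eq0.
Qed.

Let YE e x : Y e x * qA (through v) x = qA (B e) x.
Proof.
rewrite !qAE; apply: edge_prob_ratio => [u|]; first exact: p1.
exact: valP e.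
Qed.

Let vleaf : ~~ leaf v.
Proof.
move: v_branching; rewrite finset.inE => /ltnW /card_gt0P[w]; rewrite finset.inE => vw.
by apply/negP => /forallP /(_ w); rewrite vw.
Qed.

Let Ysum x : \sum_e Y e x = 1.
Proof. by rewrite -(p1 x vleaf) (big_sub (edge v)). Qed.

Let bY e : bounded_measurable (Y e).
Proof.
have Y0 e' x : 0 < Y e' x by apply: p0; exact: valP e'.
apply: bounded_measurable01 => [|x].
  by case: hp => + _ _; apply; exact: valP e.
rewrite ltW//= -(Ysum x) (bigD1 e)//= lerDl.
by apply: sumr_ge0 => i _; exact: ltW.
Qed.

Let B_disjoint e e' s : s \in B e -> s \in B e' -> e = e'.
Proof.
rewrite !finset.inE => es e's; apply/val_inj.
exact: through_child_exclusive (valP e) (valP e') es e's.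
Qed.

Let B_sub e : B e \subset through v.
Proof.
apply/fintype.subsetP => s; rewrite !finset.inE.
by apply: through_parent; exact: valP e.
Qed.

Let card_v : (1 < #|through v|)%N.
Proof.
move: v_branching; rewrite finset.inE => /card_gt1P[w [w' []]].
rewrite !finset.inE => vw vw' ww'.
have /card_gt0P[s sw] := card_through w; have /card_gt0P[s' sw'] := card_through w'.
pose e : floret_edge v := exist _ w vw; pose e' : floret_edge v := exist _ w' vw'.
apply/card_gt1P; exists s, s'; split.
- exact: (fintype.subsetP (B_sub e)).
- exact: (fintype.subsetP (B_sub e')).
- apply: contra ww' => /eqP ss'; rewrite -{}ss' in sw'.
  by have /(congr1 val)/= -> := @B_disjoint e e' s sw sw'.
Qed.

Let H N := \int[P]_x qA (through v) x ^+ N.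

Let bqA u : bounded_measurable (qA (through u)).
Proof. exact: bounded_block_sum bounded_path_prob _. Qed.

Let bqAX N : bounded_measurable (fun x => qA (through v) x ^+ N).
Proof.
elim: N => [|N ih]; first by under eq_fun do rewrite expr0; exact: bounded_measurable_cst.
by under eq_fun do rewrite exprS; exact: bounded_measurableM.
Qed.

Let H_gt0 N : 0 < H N.
Proof. by apply: Rintegral_gt0 => // x; rewrite exprn_gt0. Qed.

Let total := \sum_j alpha j.
Let mass := \sum_(j in through v) alpha j.

(** Aggregation with a single block indexed by [unit], where a word is nothing but its length. *)
Let H_rec N : H N.+1 * (total + N%:R) = (mass + N%:R) * H N.
Proof.
have HE n : moment P (fun _ : unit => qA (through v)) (nseq n tt) = H n.
  by apply: eq_Rintegral => x _; rewrite big_nseq -Monoid.iteropE.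
have := @block_sum_moments _ _ _ P J q alpha bounded_path_prob rec unit
  (fun=> through v) _ tt (nseq N tt).
rewrite -[tt :: nseq N tt]/(nseq N.+1 tt) !HE size_nseq count_nseq mul1n.
by apply => -[] [].
Qed.

Let Z_moment u : moment P (fun e => qA (B e)) u = moment P Y u * H (size u).
Proof.
have e x : \prod_(i <- u) qA (B i) x
    = qA (through v) x ^+ size u * \prod_(i <- u) Y i x.
  under eq_bigr do rewrite -YE.
  by rewrite big_split/= big_const_seq count_predT iter_mulr_1 mulrC.
rewrite /moment; under eq_Rintegral do rewrite e.
(* If every path meets [v], the hub tree has no branching root to be independent of; but then the
   mass through [v] is constantly 1. *)
have [vT|vT] := eqVneq (through v) [set: J]%SET.
  have q1 x : qA (through v) x = 1.
    by rewrite vT -(path_prob_sum x); apply: eq_bigl => j; rewrite finset.inE.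
  have -> : H (size u) = 1.
    rewrite -[RHS](Rintegral_probability_cst P 1).
    by apply: eq_Rintegral => x _; rewrite q1 expr1n.
  by rewrite mulr1; apply: eq_Rintegral => x _; rewrite q1 expr1n mul1r.
pose V x := \prod_(i <- u) Y i x.
have V0 x : 0 <= V x by apply: prodr_ge0 => i _; rewrite ltW//; apply: p0; exact: valP i.
have bV : bounded_measurable V by exact: bounded_measurable_prod.
have mV : measurable_fun (setT : set (sigma_type (@normalized (through v)))) V.
  apply: measurable_prod => i _.
  (* As sums of normalized entries, the edge probabilities are measurable for the sigma-algebra that
     [hub_expectation] requires. *)
  rewrite (_ : Y i = fun x => \sum_(s <- enum (B i)) (q s x / qA (through v) x)); last first.
    apply/funext => x; rewrite -mulr_suml big_enum/= -/(block_sum q (B i) x) -YE mulfK//.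
    by rewrite gt_eqF.
  have sub : {subset enum (B i) <= through v}.
    by move=> s; rewrite mem_enum; exact: (fintype.subsetP (B_sub i)).
  have main (l : seq J) : {subset l <= through v} ->
      measurable_fun (setT : set (sigma_type (@normalized (through v))))
        (fun x => \sum_(s <- l) (q s x / qA (through v) x)).
    elim: l => [|s l ih] sl.
      rewrite (_ : (fun x => _) = cst 0); first exact: measurable_cst.
      by apply/funext => x; rewrite big_nil.
    rewrite (_ : (fun x => _) = (fun x => q s x / qA (through v) x
        + \sum_(s' <- l) q s' x / qA (through v) x)); last first.
      by apply/funext => x; rewrite big_cons.
    apply: measurable_funD.
      have sA : s \in through v by apply: sl; rewrite inE eqxx.
      exact: (measurable_sigma_type (X := @normalized (through v)) (exist _ s sA)).
    by apply: ih => s' s'l; apply: sl; rewrite inE s'l orbT.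
  exact: main.
pose h (y : R) := `|y ^+ size u|.
have hE x : h (qA (through v) x) = qA (through v) x ^+ size u.
  by rewrite /h ger0_norm// exprn_ge0// ltW.
have mh : measurable_fun setT h.
  by apply: measurableT_comp => //; exact: measurable_funX.
have bh : bounded_measurable (fun x => h (qA (through v) x)).
  rewrite (_ : (fun x => h (qA (through v) x)) = (fun x => qA (through v) x ^+ size u)).
    exact: bqAX.
  by apply/funext => x; exact: hE.
have h0 y : 0 <= h y by exact: normr_ge0.
have := @hub_expectation (through v) h V card_v vT mh h0 bh mV bV V0.
under eq_Rintegral do rewrite hE.
under [in X in _ = X * _ -> _]eq_Rintegral do rewrite hE.
by move=> ->; rewrite mulrC.
Qed.

Lemma floret_dirichlet_law : has_dirichlet_law P (floret_vector p (v := v)).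
Proof.
pose beta e := \sum_(j in B e) alpha j.
have beta0 e : 0 < beta e.
  have /card_gt0P[j jB] := card_through (val e).
  by rewrite /beta (bigD1 j)//= ltr_wpDr// sumr_ge0// => i _; exact: ltW.
have total0 : 0 < total.
  have /card_gt0P[j _] : (0 < #|J|)%N by exact: leq_trans card_J.
  by rewrite /total (bigD1 j)//= ltr_wpDr// sumr_ge0// => i _; exact: ltW.
have Z_rec := block_sum_moments bounded_path_prob rec B_disjoint.
(* Cancelling the moments of the mass through [v] by [H_rec] replaces the total of all parameters by
   the total through [v]. *)
have Y_rec e u : moment P Y (e :: u) * (mass + (size u)%:R)
    = (beta e + (count_mem e u)%:R) * moment P Y u.
  have := Z_rec e u; rewrite !Z_moment /= => h.
  apply: (mulIf (lt0r_neq0 (H_gt0 (size u)))).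
  by rewrite -mulrA -H_rec (mulrA (moment P Y (e :: u))) h mulrA.
(* Read off from [Y_rec] at the empty word and [Ysum], in place of a proof that the sets [B e]
   partition the paths through [v]. *)
have betaE : \sum_e beta e = mass.
  have one : moment P Y [::] = 1.
    rewrite /moment; under eq_Rintegral do rewrite big_nil.
    by rewrite Rintegral_probability_cst.
  transitivity (\sum_e moment P Y [:: e] * mass).
    apply: eq_bigr => e _; have := Y_rec e [::]; rewrite /= !addr0 one mulr1.
    by move=> ->.
  rewrite -mulr_suml -[RHS]mul1r -one; congr (_ * _).
  rewrite /moment -Rintegral_bounded_sum => [|e]; last exact: bounded_measurable_prod.
  apply: eq_Rintegral => x _; rewrite big_nil -[RHS](Ysum x).
  by apply: eq_bigr => e _; rewrite big_cons big_nil mulr1.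
apply: (@has_dirichlet_law_of_moments _ _ _ P _ _ beta) => //.
- move: v_branching; rewrite finset.inE => /ltnW /card_gt0P[w]; rewrite finset.inE => vw.
  by apply/card_gt0P; exists (exist _ w vw).
- by move=> e; exact: (proj1 (bY e)).
- by move=> e x; apply: p0; exact: valP e.
- by move=> e u; rewrite betaE Y_rec.
Qed.

End Floret.

End MarkovEquivalence.

Theorem corollary7 (d : measure_display) (Omega : measurableType d)
  (R : realType) (P : probability Omega R) (T : event_tree)
  (p : finest_ceg T -> finest_ceg T -> Omega -> R) :
  random_edge_probabilities p ->
  ~ almost_surely_constant P (path_prob p) ->
  (1 < #|atomic_event (finest_ceg T)|)%N ->
  ~~ prime #|atomic_event (finest_ceg T)| ->
  (forall (C' : ceg) (f : atomic_event (finest_ceg T) -> atomic_event C'),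
     markov_equivalent p f ->
     independent_florets P (induced_edge_prob (path_prob p) f)) ->
  has_dirichlet_law P (path_prob p) /\
  (forall v : finest_ceg T, v \in branching (finest_ceg T) ->
     has_dirichlet_law P (floret_vector p (v := v))).
Proof.
move=> hp nconst m1 mprime indep.
(* A composite number exceeds 2, which supplies the third letter of the recursion. *)
have composite_gt2 n : (1 < n)%N -> ~~ prime n -> (2 < n)%N by case: n => [|[|[|]]].
have m2 : (2 < #|atomic_event T|)%N := composite_gt2 _ m1 mprime.
have [alpha alpha0 rec] := path_prob_dirichlet_moments hp indep m2 nconst.
split; last by move=> v; exact: (floret_dirichlet_law hp indep m2 alpha0 rec).
apply: (has_dirichlet_law_of_moments _ _ _ _ alpha0 rec).
- exact: ltnW m1.
- by move=> j; exact: (proj1 (bounded_path_prob hp j)).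
- exact: path_prob_pos.
- exact: path_prob_sum.
Qed.
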